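(* Let $X$ and $Y$ be non-zero Banach spaces over $\mathbb K\in\{\mathbb R,\mathbb C\}$. Then $$\max\left\{C_{\mathrm{NJ}}(X),\,C_{\mathrm{NJ}}(Y),\,\frac{2}{\eta_2(X^* )^2\eta_2(Y^* )^2}\right\}\le C_{\mathrm{NJ}}(X\widehat\otimes_{\pi}Y)\le\Theta_2(\mathcal L(X,Y^* ))^2\le2,$$ where $1/\infty=0$.
   Context: For a Banach space $X$, the von Neumann--Jordan constant is $$C_{\mathrm{NJ}}(X)=\sup\left\{\frac{\|x+y\|^{2}+\|x-y\|^{2}}{2(\|x\|^{2}+\|y\|^{2})}: x,y\in X,\ (x,y)\neq(0,0)\right\}.$$ For Banach spaces $X,Y$ over $\mathbb K$, the projective norm of $w$ in the algebraic tensor product $X\otimes Y$ is $\|w\|_\pi=\inf\{\sum_{j=1}^r\|x_j\|\|y_j\|: w=\sum_{j=1}^r x_j\otimes y_j\}$, and $X\widehat\otimes_\pi Y$ is the completion of $X\otimes Y$ for this norm. $\mathcal L(X,Y^* )$ is the space of bounded linear operators $X\to Y^*$ with the operator norm. $d(E,F)=\inf\{\|T\|\|T^{-1}\|: T:E\to F\text{ a linear isomorphism}\}$ is the Banach--Mazur distance and $\ell_2^2$ is $\mathbb K^2$ with the Euclidean norm. Define $$\eta_2(Z)=\inf\{d(E,\ell_2^2): E\subset Z,\ \dim E=2\},$$ with $\eta_2(Z)=\infty$ if $Z$ has no two-dimensional subspace, and $$\Theta_2(Z)=\sup\{d(E,\ell_2^2): E\subset Z,\ \dim E=2\},$$ with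 $\Theta_2(Z)=1$ when $\dim Z=1$. *)

(* Defs.v *)
From HB Require Import structures.
From mathcomp Require Import all_boot all_order all_algebra.
From mathcomp Require Import generic_quotient.
From mathcomp Require Import all_classical all_reals all_analysis.
From mathcomp Require Import complex.
From mathcomp Require Import ring.

Set Implicit Arguments.
Unset Strict Implicit.
Unset Printing Implicit Defensive.

Import Order.TTheory GRing.Theory Num.Theory.
Import numFieldNormedType.Exports.

Local Open Scope classical_set_scope.
Local Open Scope quotient_scope.
Local Open Scope ring_scope.

Variant scalar_kind := RealScalars | ComplexScalars.

Definition scalars (R : realType) (k : scalar_kind) : numFieldType :=
  match k with RealScalars => R : numFieldType | ComplexScalars => R[i] end.

(* Norms of a normedModType K take their values in K itself, even when K = R[i];
   toR and ofR pass between the nonnegative elements of K and those of R. *)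
Definition toR (R : realType) (k : scalar_kind) : scalars R k -> R :=
  match k with RealScalars => fun x => x | ComplexScalars => fun x => complex.Re x end.

Definition ofR (R : realType) (k : scalar_kind) : R -> scalars R k :=
  match k with RealScalars => fun x => x | ComplexScalars => fun x => x%:C%C end.
Arguments ofR {R} k x.

Section ScalarTheory.
Context (R : realType) (k : scalar_kind).
Local Notation K := (scalars R k).
Implicit Types (x y : K) (r s : R).

Lemma ofRK r : toR (ofR k r) = r. Proof. by case: k. Qed.

Lemma toRK x : 0 <= x -> ofR k (toR x) = x.
Proof.
case: k x => //= x x0; apply: RRe_real; exact: ger0_real.
Qed.

Lemma ofRD r s : ofR k (r + s) = ofR k r + ofR k s.
Proof. by case: k => //=; rewrite rmorphD. Qed.

Lemma ofRM r s : ofR k (r * s) = ofR k r * ofR k s.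
Proof. by case: k => //=; rewrite rmorphM. Qed.

Lemma ofR0 : ofR k 0 = 0 :> K. Proof. by case: k. Qed.

Lemma ofR1 : ofR k 1 = 1 :> K. Proof. by case: k. Qed.

Lemma ler_ofR r s : (ofR k r <= ofR k s) = (r <= s).
Proof. by case: k => //=; rewrite lecR. Qed.

Lemma ltr_ofR r s : (ofR k r < ofR k s) = (r < s).
Proof. by case: k => //=; rewrite ltcR. Qed.

Lemma ofR_inj : injective (@ofR R k).
Proof. exact: can_inj ofRK. Qed.

End ScalarTheory.

Section RealNorm.
Context (R : realType) (k : scalar_kind).
Local Notation K := (scalars R k).

Definition rnorm (V : normedZmodType K) (x : V) : R := toR `|x|.

Context (V : normedModType K).
Implicit Types (x y : V) (a : K).

Lemma rnormE x : ofR k (rnorm x) = `|x|. Proof. exact: toRK. Qed.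

Lemma rnorm_ge0 x : 0 <= rnorm x.
Proof. by rewrite -(ler_ofR k) ofR0 rnormE. Qed.

Lemma rnormD x y : rnorm (x + y) <= rnorm x + rnorm y.
Proof. by rewrite -(ler_ofR k) ofRD !rnormE ler_normD. Qed.

Lemma rnormZ a x : rnorm (a *: x) = toR `|a| * rnorm x.
Proof. by apply: (@ofR_inj _ k); rewrite ofRM !rnormE toRK// normrZ. Qed.

Lemma rnorm0 : rnorm (0 : V) = 0.
Proof. by apply: (@ofR_inj _ k); rewrite rnormE normr0 ofR0. Qed.

Lemma rnorm_distC x y : rnorm (x - y) = rnorm (y - x).
Proof. by rewrite /rnorm distrC. Qed.

Lemma rnorm0_eq0 x : rnorm x = 0 -> x = 0.
Proof. by move=> x0; apply/normr0_eq0; rewrite -rnormE x0 ofR0. Qed.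

End RealNorm.

Section BoundedOperators.
Context (R : realType) (k : scalar_kind).
Local Notation K := (scalars R k).

Definition bounded_linear (X Y : normedModType K) : {pred X -> Y} :=
  [pred f : X -> Y |
    `[< linear f /\ exists M : R, forall x, rnorm (f x) <= M * rnorm x >]].

Context (X Y : normedModType K).

Lemma bounded_linear_submod_closed : submod_closed (@bounded_linear X Y).
Proof.
split.
  apply/asboolP; split; first by move=> a x y; rewrite scaler0 addr0.
  by exists 0 => x; rewrite rnorm0 mul0r.
move=> a f g /asboolP[lf [M Mf]] /asboolP[lg [N Ng]]; apply/asboolP; split.
  move=> b x y; rewrite !fctE lf lg !scalerDr !scalerA.
  by rewrite [a * b]mulrC !addrA; congr (_ + _); rewrite addrAC.
exists (toR `|a| * M + N) => x; rewrite !fctE.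
apply: (le_trans (rnormD _ _)); rewrite mulrDl lerD// rnormZ -mulrA.
apply: ler_wpM2l => //.
by rewrite -(ler_ofR k) ofR0 toRK.
Qed.

HB.instance Definition _ := GRing.isSubmodClosed.Build K (X -> Y)
  (@bounded_linear X Y) bounded_linear_submod_closed.

Record boundedOp := BoundedOp {
  boundedOp_fun :> X -> Y;
  boundedOpP : boundedOp_fun \in @bounded_linear X Y }.

HB.instance Definition _ := [isSub for boundedOp_fun].
HB.instance Definition _ := [Choice of boundedOp by <:].
HB.instance Definition _ := [SubChoice_isSubLmodule of boundedOp by <:].

Lemma boundedOp_linear (f : boundedOp) : linear f.
Proof. by have /asboolP[] := boundedOpP f. Qed.

HB.instance Definition _ (f : boundedOp) :=
  GRing.isLinear.Build K X Y *:%R (boundedOp_fun f) (boundedOp_linear f).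

Definition opnorm (f : boundedOp) : R :=
  sup [set rnorm (f x) | x in [set x : X | rnorm x <= 1]].

Lemma opnorm_has_sup (f : boundedOp) :
  has_sup [set rnorm (f x) | x in [set x : X | rnorm x <= 1]].
Proof.
split; first by exists (rnorm (f 0)); exists 0 => //=; rewrite rnorm0.
have /asboolP[_ [M Mf]] := boundedOpP f.
exists `|M| => _ /= [x x1 <-]; apply: (le_trans (Mf x)).
apply: (@le_trans _ _ (`|M| * rnorm x)).
  by apply: ler_wpM2r; [exact: rnorm_ge0|exact: ler_norm].
by rewrite -[leRHS]mulr1 ler_wpM2l.
Qed.

Lemma opnorm_ubound (f : boundedOp) x : rnorm x <= 1 -> rnorm (f x) <= opnorm f.
Proof.
by move=> x1; apply: (sup_upper_bound (opnorm_has_sup f)); exists x.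
Qed.

Lemma opnorm_le (f : boundedOp) (M : R) :
  (forall x, rnorm x <= 1 -> rnorm (f x) <= M) -> opnorm f <= M.
Proof.
move=> fM; apply: ge_sup; first by have [] := opnorm_has_sup f.
by move=> _ [x x1 <-]; exact: fM.
Qed.

Lemma le_opnorm (f : boundedOp) x : rnorm (f x) <= opnorm f * rnorm x.
Proof.
have [x0|x0] := eqVneq (rnorm x) 0.
  by rewrite (rnorm0_eq0 x0) linear0 !rnorm0 mulr0.
have xgt0 : 0 < rnorm x by rewrite lt_neqAle eq_sym x0 rnorm_ge0.
pose a : K := ofR k (rnorm x)^-1.
have na : toR `|a| = (rnorm x)^-1.
  by rewrite ger0_norm ?ofRK// -(@ofR0 R k) ler_ofR invr_ge0 ltW.
have := @opnorm_ubound f (a *: x).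
rewrite linearZ/= !rnormZ na mulVf// => /(_ (lexx _)).
by rewrite mulrC ler_pdivrMr.
Qed.

Let opnormD_subproof (f g : boundedOp) :
  ofR k (opnorm (f + g)) <= ofR k (opnorm f) + ofR k (opnorm g).
Proof.
rewrite -ofRD ler_ofR; apply: opnorm_le => x x1.
by apply: (le_trans (rnormD _ _)); rewrite lerD// opnorm_ubound.
Qed.

Let opnormZ_subproof (a : K) (f : boundedOp) :
  ofR k (opnorm (a *: f)) = `|a| * ofR k (opnorm f).
Proof.
have le_opnormZ (b : K) (g : boundedOp) :
    opnorm (b *: g) <= toR `|b| * opnorm g.
  apply: opnorm_le => x x1; rewrite [X in rnorm X](_ : _ = b *: g x)//.
  rewrite rnormZ ler_wpM2l ?opnorm_ubound//.
  by rewrite -(ler_ofR k) ofR0 toRK.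
rewrite -[X in X * _]toRK// -ofRM; congr ofR; apply/le_anti.
rewrite le_opnormZ/=.
have [->|a0] := eqVneq a 0.
  rewrite normr0 -(@ofR0 R k) ofRK mul0r.
  by apply: (le_trans (rnorm_ge0 ((ofR k 0 *: f) 0))); rewrite opnorm_ubound ?rnorm0.
have := le_opnormZ a^-1 (a *: f); rewrite scalerA mulVf// scale1r.
have na0 : `|a| != 0 by rewrite normr_eq0.
have ta0 : 0 < toR `|a| by rewrite -(ltr_ofR k) ofR0 toRK// normr_gt0.
have ta : ofR k (toR `|a|)^-1 = `|a^-1|.
  apply: (mulIf na0); rewrite normfV mulVf// -[X in _ * X]toRK// -ofRM.
  by rewrite mulVf ?ofR1// gt_eqF.
by rewrite -ta ofRK => h; rewrite -ler_pdivlMl.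
Qed.

Let opnorm0_eq0_subproof (f : boundedOp) : ofR k (opnorm f) = 0 -> f = 0.
Proof.
rewrite -(@ofR0 R k) => /ofR_inj f0; apply/val_inj/funext => x /=.
apply: rnorm0_eq0; apply/le_anti; rewrite rnorm_ge0 andbT.
by have := le_opnorm f x; rewrite f0 mul0r.
Qed.

HB.instance Definition _ := Lmodule_isNormed.Build K boundedOp
  opnormD_subproof opnormZ_subproof opnorm0_eq0_subproof.

Lemma rnorm_boundedOp (f : boundedOp) : rnorm f = opnorm f.
Proof. exact: ofRK. Qed.

End BoundedOperators.

Definition dual (R : realType) (k : scalar_kind)
    (X : normedModType (scalars R k)) : normedModType (scalars R k) :=
  boundedOp X (scalars R k)^o.

Section Subspaces.
Context (R : realType) (k : scalar_kind).
Local Notation K := (scalars R k).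
Context (V : normedModType K) (E : submodClosed V).

Record subspaceOf := SubspaceOf {
  subspaceOf_val :> V;
  subspaceOfP : subspaceOf_val \in E }.

HB.instance Definition _ := [isSub for subspaceOf_val].
HB.instance Definition _ := [Choice of subspaceOf by <:].
HB.instance Definition _ := [SubChoice_isSubLmodule of subspaceOf by <:].

Let normD (x y : subspaceOf) : `|val (x + y)| <= `|val x| + `|val y|.
Proof. exact: ler_normD. Qed.

Let normZ (a : K) (x : subspaceOf) : `|val (a *: x)| = `|a| * `|val x|.
Proof. exact: normrZ. Qed.

Let norm0_eq0 (x : subspaceOf) : `|val x| = 0 -> x = 0.
Proof. by move=> /normr0_eq0 x0; apply/val_inj. Qed.

HB.instance Definition _ := Lmodule_isNormed.Build K subspaceOf
  normD normZ norm0_eq0.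

End Subspaces.

Lemma minkowski2 (F : rcfType) (a b c d : F) : 0 <= a -> 0 <= b -> 0 <= c -> 0 <= d ->
  Num.sqrt ((a + c) ^+ 2 + (b + d) ^+ 2) <=
  Num.sqrt (a ^+ 2 + b ^+ 2) + Num.sqrt (c ^+ 2 + d ^+ 2).
Proof.
move=> a0 b0 c0 d0.
set A := a ^+ 2 + b ^+ 2; set B := c ^+ 2 + d ^+ 2.
have A0 : 0 <= A by rewrite addr_ge0 ?sqr_ge0.
have B0 : 0 <= B by rewrite addr_ge0 ?sqr_ge0.
have S0 : 0 <= (a + c) ^+ 2 + (b + d) ^+ 2 by rewrite addr_ge0 ?sqr_ge0.
rewrite -(@ler_pXn2r _ 2%N)// ?nnegrE ?addr_ge0 ?sqrtr_ge0//.
rewrite (sqr_sqrtr S0) [leRHS]sqrrD (sqr_sqrtr A0) (sqr_sqrtr B0).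
have h : a * c + b * d <= Num.sqrt A * Num.sqrt B.
  rewrite -(@ler_pXn2r _ 2%N)// ?nnegrE ?addr_ge0 ?mulr_ge0 ?sqrtr_ge0//.
  rewrite exprMn !sqr_sqrtr// -subr_ge0.
  rewrite [X in 0 <= X](_ : _ = (a * d - b * c) ^+ 2) ?sqr_ge0//.
  by rewrite /A /B; ring.
rewrite [leLHS](_ : _ = A + (a * c + b * d) *+ 2 + B); last by rewrite /A /B; ring.
by rewrite lerD2r lerD2l lerMn2r.
Qed.

Section EuclideanPlane.
Context (R : realType) (k : scalar_kind).
Local Notation K := (scalars R k).

(* An alias of 'rV[K]_2, so as not to inherit the library's sup norm. *)
Definition ell22 : Type := 'rV[K]_2.

HB.instance Definition _ := GRing.Lmodule.on ell22.

Definition ell22_norm (v : ell22) : R :=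
  Num.sqrt (\sum_(i < 2) toR `|(v : 'rV[K]_2) ord0 i| ^+ 2).

Let toR_ge0 (a : K) : 0 <= toR `|a|.
Proof. by rewrite -(ler_ofR k) ofR0 toRK. Qed.

Let toR_normD (a b : K) : toR `|a + b| <= toR `|a| + toR `|b|.
Proof. by rewrite -(ler_ofR k) ofRD !toRK// ler_normD. Qed.

Let toR_normM (a b : K) : toR `|a * b| = toR `|a| * toR `|b|.
Proof. by apply: (@ofR_inj _ k); rewrite ofRM !toRK// normrM. Qed.

Let ell22_normD (u v : ell22) :
  ofR k (ell22_norm (u + v)) <= ofR k (ell22_norm u) + ofR k (ell22_norm v).
Proof.
rewrite -ofRD ler_ofR /ell22_norm !big_ord_recl !big_ord0 !addr0.
apply: le_trans; last by apply: minkowski2; exact: toR_ge0.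
by rewrite ler_wsqrtr// lerD// ler_pXn2r ?nnegrE ?addr_ge0 ?toR_ge0// mxE toR_normD.
Qed.

Let ell22_normZ (a : K) (v : ell22) :
  ofR k (ell22_norm (a *: v)) = `|a| * ofR k (ell22_norm v).
Proof.
rewrite -[X in X * _]toRK// -ofRM; congr ofR; rewrite /ell22_norm.
rewrite -[toR `|a|]ger0_norm ?toR_ge0// -sqrtr_sqr -sqrtrM ?sqr_ge0//.
by rewrite mulr_sumr; congr Num.sqrt; apply: eq_bigr => i _; rewrite mxE toR_normM exprMn.
Qed.

Let ell22_norm0_eq0 (v : ell22) : ofR k (ell22_norm v) = 0 -> v = 0.
Proof.
rewrite -(@ofR0 R k) => /ofR_inj/eqP; rewrite /ell22_norm sqrtr_eq0 => v0.
apply/matrixP => i j; rewrite ord1 mxE; apply/normr0_eq0; rewrite -[LHS]toRK//.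
suff -> : toR `|(v : 'rV[K]_2) ord0 j| = 0 by rewrite ofR0.
apply/eqP; rewrite -sqrf_eq0 eq_le sqr_ge0 andbT; apply: le_trans v0.
by rewrite (bigD1 j)//= lerDl sumr_ge0// => ? _; rewrite sqr_ge0.
Qed.

HB.instance Definition _ := Lmodule_isNormed.Build K ell22
  ell22_normD ell22_normZ ell22_norm0_eq0.

End EuclideanPlane.

Section BanachMazur.
Context (R : realType) (k : scalar_kind).
Local Notation K := (scalars R k).
Local Open Scope ereal_scope.

Definition has_dim (V : lmodType K) (n : nat) :=
  exists e : 'I_n -> V, forall v : V,
    exists! c : {ffun 'I_n -> K}, v = (\sum_(i < n) c i *: e i)%R.

(* Restricting to bounded isomorphisms with bounded inverse loses nothing: an
   unbounded one would have infinite norm, and there is none on the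
   two-dimensional spaces considered below. *)
Definition banach_mazur (E F : normedModType K) : \bar R :=
  ereal_inf [set r : \bar R | exists (T : boundedOp E F) (S : boundedOp F E),
    [/\ cancel T S, cancel S T & r = (opnorm T * opnorm S)%:E]].

(* ereal_inf set0 = +oo, the value when Z has no two-dimensional subspace. *)
Definition eta2 (Z : normedModType K) : \bar R :=
  ereal_inf [set r : \bar R | exists E : submodClosed Z,
    has_dim (subspaceOf E) 2 /\ r = banach_mazur (subspaceOf E) (ell22 R k)].

Definition Theta2 (Z : normedModType K) : \bar R :=
  if `[< has_dim Z 1 >] then 1 else
  ereal_sup [set r : \bar R | exists E : submodClosed Z,
    has_dim (subspaceOf E) 2 /\ r = banach_mazur (subspaceOf E) (ell22 R k)].

Definition CNJ (X : normedModType K) : \bar R :=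
  ereal_sup [set ((rnorm (z.1 + z.2) ^+ 2 + rnorm (z.1 - z.2) ^+ 2) /
      (2 * (rnorm z.1 ^+ 2 + rnorm z.2 ^+ 2)))%:E |
    z in [set z : X * X | z <> (0, 0)%R]].

End BanachMazur.

Section Tensor.
Context (K : numFieldType) (X Y : lmodType K).

Definition tensor_val (V : lmodType K) (b : X -> Y -> V) (s : seq (X * Y)) : V :=
  \sum_(p <- s) b p.1 p.2.

(* A list s stands for the tensor \sum_(p <- s) p.1 (x) p.2 (see tensor_pi_sum):
   scalar coefficients can be absorbed in the first factors. Two lists denote
   the same tensor iff every bilinear map takes the same value on both, which is
   the universal property of the algebraic tensor product; see tensor_lift_tens
   and tensor_sumP. *)
Definition tensor_equiv (s t : seq (X * Y)) : bool :=
  `[< forall (V : lmodType K) (b : {bilinear X -> Y -> V}),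
      tensor_val b s = tensor_val b t >].

Let tensor_equiv_refl : reflexive tensor_equiv.
Proof. by move=> s; apply/asboolP. Qed.

Let tensor_equiv_sym : symmetric tensor_equiv.
Proof. by move=> s t; apply/asboolP/asboolP => h V b; rewrite h. Qed.

Let tensor_equiv_trans : transitive tensor_equiv.
Proof.
by move=> t s u /asboolP st /asboolP tu; apply/asboolP => V b; rewrite st.
Qed.

Canonical tensor_equivRel := EquivRel tensor_equiv
  tensor_equiv_refl tensor_equiv_sym tensor_equiv_trans.

Definition tensor : Type := {eq_quot tensor_equiv}.

HB.instance Definition _ := Choice.on tensor.
HB.instance Definition _ := EqQuotient.on tensor.

Definition tensor_lift (V : lmodType K) (b : X -> Y -> V) (w : tensor) : V :=
  tensor_val b (repr w).

Lemma tensor_lift_pi (V : lmodType K) (b : {bilinear X -> Y -> V}) s :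
  tensor_lift b (\pi_tensor s) = tensor_val b s.
Proof.
rewrite /tensor_lift; have /eqmodP/asboolP := reprK (\pi_tensor s); exact.
Qed.

Lemma tensor_ext (v w : tensor) :
  (forall (V : lmodType K) (b : {bilinear X -> Y -> V}),
    tensor_lift b v = tensor_lift b w) -> v = w.
Proof.
by move=> h; rewrite -[v]reprK -[w]reprK; apply/eqmodP/asboolP => V b; exact: h.
Qed.

Definition tensor_scale_seq (a : K) (s : seq (X * Y)) : seq (X * Y) :=
  [seq (a *: p.1, p.2) | p <- s].

Definition tensor0 : tensor := \pi_tensor [::].
Definition tensor_add (v w : tensor) : tensor := \pi_tensor (repr v ++ repr w).
Definition tensor_scale (a : K) (v : tensor) : tensor :=
  \pi_tensor (tensor_scale_seq a (repr v)).
Definition tensor_opp (v : tensor) : tensor := tensor_scale (-1) v.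

Section Lift.
Context (V : lmodType K) (b : {bilinear X -> Y -> V}).

Let lift0 : tensor_lift b tensor0 = 0.
Proof. by rewrite tensor_lift_pi /tensor_val big_nil. Qed.

Let liftD v w :
  tensor_lift b (tensor_add v w) = tensor_lift b v + tensor_lift b w.
Proof. by rewrite tensor_lift_pi /tensor_val big_cat. Qed.

Let liftZ a v : tensor_lift b (tensor_scale a v) = a *: tensor_lift b v.
Proof.
rewrite tensor_lift_pi /tensor_val big_map scaler_sumr.
by apply: eq_bigr => p _; rewrite linearZl_LR.
Qed.

Definition tensor_liftE := (lift0, liftD, liftZ).

End Lift.

Let tensor_addA : associative tensor_add.
Proof. by move=> u v w; apply: tensor_ext => V b; rewrite !tensor_liftE addrA. Qed.

Let tensor_addC : commutative tensor_add.
Proof. by move=> v w; apply: tensor_ext => V b; rewrite !tensor_liftE addrC. Qed.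

Let tensor_add0 : left_id tensor0 tensor_add.
Proof. by move=> v; apply: tensor_ext => V b; rewrite !tensor_liftE add0r. Qed.

Let tensor_addN : left_inverse tensor0 tensor_opp tensor_add.
Proof.
by move=> v; apply: tensor_ext => V b; rewrite !tensor_liftE scaleN1r addNr.
Qed.

HB.instance Definition _ := GRing.isZmodule.Build tensor
  tensor_addA tensor_addC tensor_add0 tensor_addN.

Let tensor_scaleA a a' v : tensor_scale a (tensor_scale a' v) = tensor_scale (a * a') v.
Proof. by apply: tensor_ext => V b; rewrite !tensor_liftE scalerA. Qed.

Let tensor_scale1 : left_id 1 tensor_scale.
Proof. by move=> v; apply: tensor_ext => V b; rewrite !tensor_liftE scale1r. Qed.

Let tensor_scaleDr : right_distributive tensor_scale +%R.
Proof. by move=> a v w; apply: tensor_ext => V b; rewrite !tensor_liftE scalerDr. Qed.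

Let tensor_scaleDl v : {morph tensor_scale^~ v : a a' / a + a'}.
Proof. by move=> a a'; apply: tensor_ext => V b; rewrite !tensor_liftE scalerDl. Qed.

HB.instance Definition _ := GRing.Zmodule_isLmodule.Build K tensor
  tensor_scaleA tensor_scale1 tensor_scaleDr tensor_scaleDl.

Lemma tensor_lift_linear (V : lmodType K) (b : {bilinear X -> Y -> V}) :
  linear (tensor_lift b).
Proof. by move=> a v w; rewrite !tensor_liftE. Qed.

Definition tens (x : X) (y : Y) : tensor := \pi_tensor [:: (x, y)].

Lemma tensor_lift_tens (V : lmodType K) (b : {bilinear X -> Y -> V}) x y :
  tensor_lift b (tens x y) = b x y.
Proof. by rewrite tensor_lift_pi /tensor_val big_seq1. Qed.

Lemma tens_bilinear : bilinear_for *:%R *:%R tens.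
Proof.
by split=> u a v w; apply: tensor_ext => V b;
  rewrite !tensor_liftE !tensor_lift_tens ?linearPl ?linearPr.
Qed.

HB.instance Definition _ :=
  bilinear_isBilinear.Build K X Y tensor *:%R *:%R tens tens_bilinear.

Lemma tensor_pi_sum s : \pi_tensor s = \sum_(p <- s) tens p.1 p.2.
Proof.
apply: tensor_ext => V b; rewrite tensor_lift_pi.
elim: s => [|p s ih]; rewrite /tensor_val ?big_nil ?big_cons ?tensor_liftE//.
by rewrite tensor_lift_tens -ih.
Qed.

Lemma tensor_sumP w : exists s : seq (X * Y), w = \sum_(p <- s) tens p.1 p.2.
Proof. by exists (repr w); rewrite -tensor_pi_sum reprK. Qed.

End Tensor.

Record seminorm (R : realType) (k : scalar_kind) (T : lmodType (scalars R k)) :=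
  Seminorm {
    seminorm_fun :> T -> R;
    seminormD : forall x y, seminorm_fun (x + y) <= seminorm_fun x + seminorm_fun y;
    seminormZ : forall a x, seminorm_fun (a *: x) = toR `|a| * seminorm_fun x }.

Section Completion.
Context (R : realType) (k : scalar_kind).
Local Notation K := (scalars R k).
Context (T : lmodType K) (p : seminorm T).

Lemma seminorm0 : p 0 = 0.
Proof. by rewrite -(scale0r 0) seminormZ normr0 -(@ofR0 R k) ofRK mul0r. Qed.

Lemma seminormN x : p (- x) = p x.
Proof. by rewrite -scaleN1r seminormZ normrN1 -(@ofR1 R k) ofRK mul1r. Qed.

Lemma seminorm_distC x y : p (x - y) = p (y - x).
Proof. by rewrite -seminormN opprB. Qed.

Lemma seminorm_ge0 x : 0 <= p x.
Proof.
have := seminormD p x (- x); rewrite subrr seminorm0 seminormN => h.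
by rewrite -(pmulrn_lge0 _ (ltn0Sn 1)) mulr2n.
Qed.

Lemma seminorm_dist x y : `|p x - p y| <= p (x - y).
Proof.
have h a b : p a - p b <= p (a - b).
  by rewrite lerBlDr -[X in p X <= _](subrK b a) seminormD.
by rewrite ler_norml h andbT lerNl opprB seminorm_distC h.
Qed.

Definition cauchy_seq : {pred nat -> T} := [pred u : nat -> T |
  `[< forall e : R, 0 < e -> exists N : nat, forall m n : nat,
      (N <= m)%N -> (N <= n)%N -> p (u m - u n) < e >]].

Definition null_seq : {pred nat -> T} := [pred u : nat -> T |
  `[< forall e : R, 0 < e -> exists N : nat, forall n : nat,
      (N <= n)%N -> p (u n) < e >]].

Lemma cauchy_seq_submod_closed : submod_closed cauchy_seq.
Proof.
split.
  by apply/asboolP => e e0; exists 0%N => m n _ _; rewrite subrr seminorm0.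
move=> a u v /asboolP cu /asboolP cv; apply/asboolP => e e0.
have c0 : 0 < toR `|a| + 1.
  by rewrite ltr_wpDl// -(ler_ofR k) ofR0 toRK.
have [N uN] := cu (e / 2 / (toR `|a| + 1)) (divr_gt0 (divr_gt0 e0 (ltr0Sn _ 1)) c0).
have [M vM] := cv (e / 2) (divr_gt0 e0 (ltr0Sn _ 1)).
exists (maxn N M) => m n; rewrite !geq_max => /andP[Nm Mm] /andP[Nn Mn].
rewrite !fctE opprD addrACA -scalerBr [e]splitr.
apply: (le_lt_trans (seminormD _ _ _)); apply: ler_ltD; last exact: vM.
rewrite seminormZ; have := uN _ _ Nm Nn; rewrite ltr_pdivlMr// => /ltW.
apply: le_trans; rewrite mulrC ler_wpM2l ?seminorm_ge0// lerDl//.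
Qed.

HB.instance Definition _ := GRing.isSubmodClosed.Build K (nat -> T)
  cauchy_seq cauchy_seq_submod_closed.

Lemma null_seq_submod_closed : submod_closed null_seq.
Proof.
split; first by apply/asboolP => e e0; exists 0%N => n _; rewrite seminorm0.
move=> a u v /asboolP cu /asboolP cv; apply/asboolP => e e0.
have c0 : 0 < toR `|a| + 1.
  by rewrite ltr_wpDl// -(ler_ofR k) ofR0 toRK.
have [N uN] := cu (e / 2 / (toR `|a| + 1)) (divr_gt0 (divr_gt0 e0 (ltr0Sn _ 1)) c0).
have [M vM] := cv (e / 2) (divr_gt0 e0 (ltr0Sn _ 1)).
exists (maxn N M) => n; rewrite !geq_max => /andP[Nn Mn].
rewrite !fctE [e]splitr.
apply: (le_lt_trans (seminormD _ _ _)); apply: ler_ltD; last exact: vM.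
rewrite seminormZ; have := uN _ Nn; rewrite ltr_pdivlMr// => /ltW.
apply: le_trans; rewrite mulrC ler_wpM2l ?seminorm_ge0// lerDl//.
Qed.

HB.instance Definition _ := GRing.isSubmodClosed.Build K (nat -> T)
  null_seq null_seq_submod_closed.

(* The completion is the space of Cauchy sequences modulo null sequences. The map
   completion_in below is linear and isometric, with dense range. *)
Record cauchySeq := CauchySeq {
  cauchySeq_fun :> nat -> T;
  cauchySeqP : cauchySeq_fun \in cauchy_seq }.

HB.instance Definition _ := [isSub for cauchySeq_fun].
HB.instance Definition _ := [Choice of cauchySeq by <:].
HB.instance Definition _ := [SubChoice_isSubLmodule of cauchySeq by <:].

Implicit Types (u v w : cauchySeq).

Definition completion_equiv u v : bool := (val (u - v)) \in null_seq.

Let completion_equiv_refl : reflexive completion_equiv.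
Proof. by move=> u; rewrite /completion_equiv subrr raddf0 rpred0. Qed.

Let completion_equiv_sym : symmetric completion_equiv.
Proof. by move=> u v; rewrite /completion_equiv -opprB raddfN rpredN. Qed.

Let completion_equiv_trans : transitive completion_equiv.
Proof.
move=> v u w; rewrite /completion_equiv => uv vw.
by rewrite -(subrKA v) raddfD rpredD.
Qed.

Canonical completion_equivRel := EquivRel completion_equiv
  completion_equiv_refl completion_equiv_sym completion_equiv_trans.

Definition completion : Type := {eq_quot completion_equiv}.

HB.instance Definition _ := Choice.on completion.
HB.instance Definition _ := EqQuotient.on completion.

Lemma completion_piE u v :
  (\pi_completion u = \pi_completion v) <-> val (u - v) \in null_seq.
Proof.
by split=> h; [have /eqmodP h' := h; exact: h' | apply/eqmodP; exact: h].
Qed.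

Implicit Types (x y z : completion).

Definition completion_add x y : completion := \pi_completion (repr x + repr y).
Definition completion_opp x : completion := \pi_completion (- repr x).
Definition completion_scale (a : K) x : completion := \pi_completion (a *: repr x).

Let piB u : val (repr (\pi_completion u) - u) \in null_seq.
Proof. by apply/completion_piE; rewrite reprK. Qed.

Let addE u v :
  completion_add (\pi_completion u) (\pi_completion v) = \pi_completion (u + v).
Proof. by apply/completion_piE; rewrite opprD addrACA raddfD rpredD ?piB. Qed.

Let oppE u : completion_opp (\pi_completion u) = \pi_completion (- u).
Proof. by apply/completion_piE; rewrite -opprD raddfN rpredN piB. Qed.

Let scaleE a u :
  completion_scale a (\pi_completion u) = \pi_completion (a *: u).
Proof. by apply/completion_piE; rewrite -scalerBr linearZ rpredZ ?piB. Qed.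

Let piP x : exists u, x = \pi_completion u.
Proof. by exists (repr x); rewrite reprK. Qed.

Let addA : associative completion_add.
Proof.
move=> x y z; have [[[u ->] [v ->]] [w ->]] := (piP x, piP y, piP z).
by rewrite (addE v w) (addE u v) !addE addrA.
Qed.

Let addC : commutative completion_add.
Proof.
by move=> x y; have [[u ->] [v ->]] := (piP x, piP y); rewrite !addE addrC.
Qed.

Let add0 : left_id (\pi_completion 0) completion_add.
Proof. by move=> x; have [u ->] := piP x; rewrite addE add0r. Qed.

Let addN : left_inverse (\pi_completion 0) completion_opp completion_add.
Proof. by move=> x; have [u ->] := piP x; rewrite oppE addE addNr. Qed.

HB.instance Definition _ := GRing.isZmodule.Build completion addA addC add0 addN.

Let scaleA a b x :
  completion_scale a (completion_scale b x) = completion_scale (a * b) x.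
Proof. by have [u ->] := piP x; rewrite (scaleE b u) !scaleE scalerA. Qed.

Let scale1 : left_id 1 completion_scale.
Proof. by move=> x; have [u ->] := piP x; rewrite scaleE scale1r. Qed.

Let scaleDr : right_distributive completion_scale +%R.
Proof.
move=> a x y; have [[u ->] [v ->]] := (piP x, piP y).
rewrite (addE u v : \pi_completion u + \pi_completion v = _) !scaleE.
by rewrite (addE _ _ : \pi_completion _ + \pi_completion _ = _) scalerDr.
Qed.

Let scaleDl x : {morph completion_scale^~ x : a b / a + b}.
Proof.
move=> a b; have [u ->] := piP x; rewrite !scaleE.
by rewrite (addE _ _ : \pi_completion _ + \pi_completion _ = _) scalerDl.
Qed.

HB.instance Definition _ := GRing.Zmodule_isLmodule.Build K completion
  scaleA scale1 scaleDr scaleDl.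

Lemma completion_piD u v :
  \pi_completion (u + v) = \pi_completion u + \pi_completion v.
Proof. by rewrite -addE. Qed.

Lemma completion_piZ a u : \pi_completion (a *: u) = a *: \pi_completion u.
Proof. by rewrite -scaleE. Qed.

Lemma completion_piB u v :
  \pi_completion (u - v) = \pi_completion u - \pi_completion v.
Proof. by rewrite completion_piD -scaleN1r completion_piZ scaleN1r. Qed.

Definition completion_norm x : R := limn (fun n => p (repr x n)).

Lemma cauchySeq_is_cvg u : cvgn (fun n => p (u n)).
Proof.
apply: R_complete; apply/cauchy_ballP => e e0.
have /asboolP/(_ e e0)[N uN] := cauchySeqP u.
pose S := [set p (u n) | n in [set n | (N <= n)%N]].
have FS : \forall n \near \oo, S (p (u n)) by exists N => // n Nn; exists n.
exists (S, S); first by split.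
move=> [_ _] [[m /= Nm <-] [n /= Nn <-]]; rewrite /ball/=.
exact: le_lt_trans (seminorm_dist _ _) (uN _ _ Nm Nn).
Qed.

Lemma null_seq_cvg (u : nat -> T) :
  u \in null_seq <-> (fun n => p (u n)) @ \oo --> (0 : R).
Proof.
split=> [/asboolP nu|/cvgrPdist_lt nu].
  apply/cvgrPdist_lt => e e0; have [N uN] := nu e e0.
  by exists N => // n /= /uN; rewrite sub0r normrN ger0_norm ?seminorm_ge0.
apply/asboolP => e e0; have [N _ uN] := nu e e0.
by exists N => n /uN; rewrite /= sub0r normrN ger0_norm ?seminorm_ge0.
Qed.

Lemma completion_norm_cvg u :
  (fun n => p (u n)) @ \oo --> completion_norm (\pi_completion u).
Proof.
rewrite /completion_norm; set v := repr _.
suff -> : limn (fun n => p (v n)) = limn (fun n => p (u n)).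
  exact: cauchySeq_is_cvg.
apply/cvg_lim => //.
have -> : (fun n => p (v n)) = (fun n => (p (v n) - p (u n)) + p (u n)).
  by apply/funext => n; rewrite subrK.
rewrite -[limn _]add0r; apply: cvgD; last exact: cauchySeq_is_cvg.
have /null_seq_cvg/cvgrPdist_lt nul := piB u.
apply/cvgrPdist_lt => e /nul; apply: filterS => n.
rewrite !sub0r !normrN; apply: le_lt_trans.
by apply: (le_trans (seminorm_dist _ _)); exact: ler_norm.
Qed.

Lemma completion_norm_ge0 x : 0 <= completion_norm x.
Proof.
apply: limr_ge; first exact: cauchySeq_is_cvg.
by apply: nearW => n; exact: seminorm_ge0.
Qed.

Let completion_normD x y :
  completion_norm (x + y) <= completion_norm x + completion_norm y.
Proof.
have [[u ->] [v ->]] := (piP x, piP y); rewrite -completion_piD.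
have cu := @completion_norm_cvg u; have cv := @completion_norm_cvg v.
have cuv := @completion_norm_cvg (u + v).
apply: (ler_cvg_to cuv (cvgD cu cv)); apply: nearW => n /=.
exact: seminormD.
Qed.

Let completion_normZ (a : K) x :
  completion_norm (a *: x) = toR `|a| * completion_norm x.
Proof.
have [u ->] := piP x; rewrite -completion_piZ.
have cu := @completion_norm_cvg u; have cau := @completion_norm_cvg (a *: u).
apply: (cvg_unique _ cau) => //.
have -> : (fun n => p ((a *: u) n)) = (fun n => toR `|a| * p (u n)).
  by apply/funext => n; exact: seminormZ.
by apply: cvgM cu; exact: cvg_cst.
Qed.

Let completion_norm0_eq0 x : completion_norm x = 0 -> x = 0.
Proof.
have [u ->] := piP x => u0; apply/completion_piE; rewrite subr0.
by apply/null_seq_cvg; rewrite -u0; exact: completion_norm_cvg.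
Qed.

Let normD x y : ofR k (completion_norm (x + y)) <=
  ofR k (completion_norm x) + ofR k (completion_norm y).
Proof. by rewrite -ofRD ler_ofR. Qed.

Let normZ (a : K) x :
  ofR k (completion_norm (a *: x)) = `|a| * ofR k (completion_norm x).
Proof. by rewrite -[X in X * _]toRK// -ofRM completion_normZ. Qed.

Let norm0_eq0 x : ofR k (completion_norm x) = 0 -> x = 0.
Proof. by rewrite -(@ofR0 R k) => /ofR_inj; exact: completion_norm0_eq0. Qed.

HB.instance Definition _ := Lmodule_isNormed.Build K completion
  normD normZ norm0_eq0.

Lemma rnorm_completion x : rnorm x = completion_norm x.
Proof. exact: ofRK. Qed.

Let const_cauchy (t : T) : (fun=> t) \in cauchy_seq.
Proof.
by apply/asboolP => e e0; exists 0%N => m n _ _; rewrite subrr seminorm0.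
Qed.

Definition completion_in (t : T) : completion :=
  \pi_completion (CauchySeq (const_cauchy t)).

Lemma completion_in_linear : linear completion_in.
Proof.
move=> a t s; rewrite /completion_in -completion_piZ -completion_piD.
by congr (\pi_completion _); apply/val_inj/funext.
Qed.

HB.instance Definition _ :=
  GRing.isLinear.Build K T completion *:%R completion_in completion_in_linear.

Lemma rnorm_completion_in t : rnorm (completion_in t) = p t.
Proof.
have h := @completion_norm_cvg (CauchySeq (const_cauchy t)).
by rewrite rnorm_completion; apply: (cvg_unique _ h) => //; exact: (cvg_cst (p t)).
Qed.

Let completion_in_approx u (e : R) : 0 < e -> exists N : nat, forall n : nat,
  (N <= n)%N -> rnorm (\pi_completion u - completion_in (u n)) <= e.
Proof.
move=> e0; have /asboolP/(_ e e0)[N uN] := cauchySeqP u.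
exists N => n Nn; rewrite rnorm_completion -completion_piB.
apply: (cvgr_to_le (@completion_norm_cvg _)).
by exists N => // m /= Nm; apply: ltW; exact: uN.
Qed.

Lemma completion_in_dense x (e : R) :
  0 < e -> exists t : T, rnorm (x - completion_in t) < e.
Proof.
move=> e0; have [u ->] := piP x.
have [N uN] := completion_in_approx u (divr_gt0 e0 (ltr0Sn _ 1)).
exists (u N); apply: (le_lt_trans (uN _ (leqnn _))).
by rewrite ltr_pdivrMr// ltr_pMr// ltr1n.
Qed.

Let ball_rnorm x (e : R) y : ball x (ofR k e) y <-> rnorm (x - y) < e.
Proof. by rewrite -ball_normE /ball_/= -rnormE ltr_ofR. Qed.

Let completion_complete (F : set_system completion) :
  ProperFilter F -> cauchy F -> cvg F.
Proof.
move=> FF cF; pose d (n : nat) : R := n.+1%:R^-1.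
have d0 n : 0 < d n by rewrite invr_gt0 ltr0Sn.
have rnorm_tri x y z : rnorm (x - z) <= rnorm (x - y) + rnorm (y - z).
  by rewrite -[X in rnorm X <= _](subrKA y) rnormD.
have [t Ft] : exists t : nat -> T,
    forall n, F (ball (completion_in (t n)) (ofR k (d n))).
  suff /choice[t tP] : forall n, exists t, F (ball (completion_in t) (ofR k (d n))).
    by exists t.
  move=> n; have dn2 : 0 < d n / 2 by rewrite divr_gt0.
  have [|x Fx] := (cauchyP F).1 cF (ofR k (d n / 2)).
    by rewrite -(@ofR0 R k) ltr_ofR.
  have [t xt] := completion_in_dense x dn2; exists t; apply: filterS Fx => y.
  move=> /ball_rnorm xy; apply/ball_rnorm; apply: (le_lt_trans (rnorm_tri _ x _)).
  by rewrite [ltRHS]splitr ltrD// rnorm_distC.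
have tP m n : p (t m - t n) < d m + d n.
  have [y [/ball_rnorm my /ball_rnorm ny]] := filter_ex (filterI (Ft m) (Ft n)).
  rewrite -rnorm_completion_in linearB/=; apply: (le_lt_trans (rnorm_tri _ y _)).
  by rewrite ltrD// rnorm_distC.
have dP (e : R) : 0 < e -> exists N : nat, forall n : nat, (N <= n)%N -> d n < e.
  by move=> e0; have [N _ NP] := near_infty_natSinv_lt (PosNum e0); exists N.
have ct : t \in cauchy_seq.
  apply/asboolP => e e0; have [N NP] := dP _ (divr_gt0 e0 (ltr0Sn _ 1)).
  exists N => m n Nm Nn; apply: (lt_trans (tP m n)).
  by rewrite [ltRHS]splitr ltrD// NP.
apply/cvg_ex; exists (\pi_completion (CauchySeq ct)); apply/cvg_ballP => e e0.
have te : e = ofR k (toR e) by rewrite toRK// ltW.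
have e20 : 0 < toR e / 2 by rewrite divr_gt0// -(ltr_ofR k) -te ofR0.
have [N NP] := dP _ e20.
have [M MP] := completion_in_approx (CauchySeq ct) e20.
apply: filterS (Ft (maxn N M)) => y /ball_rnorm ty; rewrite te; apply/ball_rnorm.
apply: (le_lt_trans (rnorm_tri _ (completion_in (t (maxn N M))) _)).
rewrite [ltRHS]splitr; apply: ler_ltD; first exact: (MP _ (leq_maxr _ _)).
by apply: (lt_trans ty); rewrite NP// leq_maxl.
Qed.

HB.instance Definition _ := Uniform_isComplete.Build completion completion_complete.

End Completion.

Section ProjectiveTensor.
Context (R : realType) (k : scalar_kind).
Local Notation K := (scalars R k).
Context (X Y : normedModType K).
Implicit Types (s t : seq (X * Y)) (v w : tensor X Y).

Definition proj_cost s : R := \sum_(q <- s) rnorm q.1 * rnorm q.2.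

Definition proj_norm w : R :=
  inf [set proj_cost s | s in [set s | w = \sum_(q <- s) tens q.1 q.2]].

Lemma proj_cost_ge0 s : 0 <= proj_cost s.
Proof. by apply: sumr_ge0 => q _; rewrite mulr_ge0 ?rnorm_ge0. Qed.

Lemma proj_norm_le s : proj_norm (\sum_(q <- s) tens q.1 q.2) <= proj_cost s.
Proof.
apply: ge_inf; last by exists s.
by exists 0 => _ [t _ <-]; exact: proj_cost_ge0.
Qed.

Lemma proj_norm_ge w (c : R) :
  (forall s, w = \sum_(q <- s) tens q.1 q.2 -> c <= proj_cost s) ->
  c <= proj_norm w.
Proof.
move=> h; apply: lb_le_inf; last by move=> _ [s ws <-]; exact: h.
by have [s ws] := tensor_sumP w; exists (proj_cost s); exists s.
Qed.

Let proj_normD v w : proj_norm (v + w) <= proj_norm v + proj_norm w.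
Proof.
rewrite -lerBlDr; apply: proj_norm_ge => s vs; rewrite lerBlDr -lerBlDl.
apply: proj_norm_ge => t wt; rewrite lerBlDl vs wt -big_cat/=.
by apply: (le_trans (proj_norm_le _)); rewrite /proj_cost big_cat.
Qed.

Let proj_normZ (a : K) w : proj_norm (a *: w) = toR `|a| * proj_norm w.
Proof.
have toR_ge0 (b : K) : 0 <= toR `|b| by rewrite -(ler_ofR k) ofR0 toRK.
have le_cost (b : K) s : proj_norm (b *: \sum_(q <- s) tens q.1 q.2) <= toR `|b| * proj_cost s.
  pose s' := [seq (b *: q.1, q.2) | q <- s].
  have -> : b *: \sum_(q <- s) tens q.1 q.2 = \sum_(q <- s') tens q.1 q.2.
    by rewrite big_map scaler_sumr; apply: eq_bigr => q _; rewrite linearZl_LR.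
  apply: (le_trans (proj_norm_le _)).
  rewrite /proj_cost big_map mulr_sumr; apply: ler_sum => q _.
  by rewrite rnormZ mulrA.
have leZ (b : K) v : b != 0 -> proj_norm (b *: v) <= toR `|b| * proj_norm v.
  move=> b0; have tb0 : 0 < toR `|b|.
    by rewrite -(ltr_ofR k) ofR0 toRK// normr_gt0.
  rewrite -ler_pdivrMl//; apply: proj_norm_ge => s ->.
  by rewrite ler_pdivrMl.
apply/le_anti/andP; split.
  have [->|a0] := eqVneq a 0; last exact: leZ.
  rewrite scale0r normr0 -(@ofR0 R k) ofRK mul0r.
  by have := proj_norm_le [::]; rewrite /proj_cost !big_nil.
have [->|a0] := eqVneq a 0.
  rewrite normr0 -(@ofR0 R k) ofRK mul0r.
  by apply: proj_norm_ge => s _; exact: proj_cost_ge0.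
have := leZ a^-1 (a *: w); rewrite scalerA mulVf// scale1r invr_eq0 => /(_ a0).
have -> : toR `|a^-1| = (toR `|a|)^-1.
  apply: (@ofR_inj _ k); apply: (@mulfI _ `|a|); first by rewrite normr_eq0.
  rewrite toRK// normfV mulfV ?normr_eq0// -[X in X * _]toRK// -ofRM mulfV ?ofR1//.
  by rewrite gt_eqF// -(ltr_ofR k) ofR0 toRK// normr_gt0.
by rewrite ler_pdivlMl// -(ltr_ofR k) ofR0 toRK// normr_gt0.
Qed.

Definition proj_seminorm : seminorm (tensor X Y) := Seminorm proj_normD proj_normZ.

(* Only the seminorm axioms of proj_norm are established here; since it is in fact
   a norm, quotienting by null sequences gives its completion in the usual sense. *)
Definition proj_tensor : completeNormedModType K := completion proj_seminorm.

End ProjectiveTensor.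

(* Main.v *)
From HB Require Import structures.
Require Import Defs.
From mathcomp Require Import all_boot all_order all_algebra.
From mathcomp Require Import all_classical all_reals all_analysis.
From mathcomp Require Import complex.
From mathcomp Require Import ring lra.

Set Implicit Arguments.
Unset Strict Implicit.
Unset Printing Implicit Defensive.

Import Order.TTheory GRing.Theory Num.Theory.
Import numFieldNormedType.Exports.

Local Open Scope classical_set_scope.
Local Open Scope ring_scope.

(** The upper bounds rest on duality. The bounded operators from X to the dual of Y are
the functionals on the projective tensor product, A acting by x (x) y |-> (A x) y. Let
F and G be functionals of norm at most 1 which attain a = |u + v| and b = |u - v| at
u + v and at u - v. Then
  a^2 + b^2 <= |(a F + b G) u| + |(a F - b G) v|
            <= |a F + b G| |u| + |a F - b G| |v|,
and by the Cauchy-Schwarz inequality a parallelogram inequality for the operators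
a F and b G passes to u and v with the same constant (proj_tensor_parallelogram). Two
operators lie in a common plane, and an isomorphism of this plane with the Euclidean
plane of distortion D transports the parallelogram law with the loss D^2
(banach_mazur_parallelogram, Theta2_parallelogram).

That Theta_2 is at most sqrt 2 is John's theorem in dimension two
(banach_mazur_le_sqrt2). Among the linear images of the Euclidean disc contained in
the unit ball of the plane take one of nearly maximal determinant. If some vector of
the unit ball had Euclidean length larger than sqrt 2, then the convex hull of the disc
and of the multiples of that vector by scalars of modulus 1 would contain an ellipse of
larger determinant (contractive_pair_stretch).

The constants of X and of Y are lower bounds because x |-> x (x) y and y |-> x (x) y are
isometries for unit vectors y and x (rnorm_tens). For the remaining lower bound, a
plane of the dual of X close to the Euclidean one yields functionals f1, f2 on X with
a dual basis x1, x2 in X of controlled norm, by Helly's theorem (eta2_dual_basis); let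
g1, g2 and y1, y2 come from Y in the same way. With suitable scalings, the tensors
u = x1 (x) y1 and v = x2 (x) y2 have norm close to 1 while u + v and u - v have norm
close to 2, as the forms f1 (x) g1 + f2 (x) g2 and f1 (x) g1 - f2 (x) g2 show: in the
Euclidean case these are diagonal matrices in the nuclear norm, for which the
von Neumann-Jordan quotient is 2. A distortion of the two planes by d and d' divides
this quotient by at most d^2 d'^2 (eta2_CNJ_bound).

All functionals come from the Hahn-Banach theorem for a seminorm on a real or complex
vector space (hahn_banach), obtained from minimal sublinear functionals. *)

Local Notation sabs a := (toR `|a|).

(** * Moduli and conjugates of scalars *)

Section Scalars.
Context (R : realType) (k : scalar_kind).
Local Notation K := (scalars R k).
Implicit Types (a b : K) (r : R).

Lemma sabs_ge0 a : 0 <= sabs a.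
Proof. by rewrite -(ler_ofR k) ofR0 toRK. Qed.

Lemma sabsM a b : sabs (a * b) = sabs a * sabs b.
Proof. by apply: (@ofR_inj _ k); rewrite ofRM !toRK// normrM. Qed.

Lemma sabsD a b : sabs (a + b) <= sabs a + sabs b.
Proof. by rewrite -(ler_ofR k) ofRD !toRK// ler_normD. Qed.

Lemma sabs0 : sabs (0 : K) = 0.
Proof. by rewrite normr0 -(@ofR0 R k) ofRK. Qed.

Lemma sabs1 : sabs (1 : K) = 1.
Proof. by rewrite normr1 -(@ofR1 R k) ofRK. Qed.

Lemma sabsN a : sabs (- a) = sabs a.
Proof. by rewrite normrN. Qed.

Lemma sabs_eq0 a : (sabs a == 0) = (a == 0).
Proof.
rewrite -[RHS]normr_eq0 -[X in _ = (X == 0)]toRK//.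
by rewrite -(@ofR0 R k) (inj_eq (@ofR_inj R k)).
Qed.

Lemma sabs_gt0 a : (0 < sabs a) = (a != 0).
Proof. by rewrite lt_neqAle sabs_ge0 andbT eq_sym sabs_eq0. Qed.

Lemma sabsV a : sabs a^-1 = (sabs a)^-1.
Proof.
have [->|a0] := eqVneq a 0; first by rewrite invr0 sabs0 invr0.
have s0 : sabs a != 0 by rewrite sabs_eq0.
by apply: (mulIf s0); rewrite -sabsM !mulVf// sabs1.
Qed.

Lemma sabs_ofR r : 0 <= r -> sabs (ofR k r) = r.
Proof. by move=> r0; rewrite ger0_norm ?ofRK// -(@ofR0 R k) ler_ofR. Qed.

Lemma toRD a b : toR (a + b) = toR a + toR b.
Proof. by case: k a b => //= -[? ?] [? ?]. Qed.

Lemma toRZ r a : toR (ofR k r * a) = r * toR a.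
Proof. by case: k a => //= -[x y] /=; rewrite mul0r subr0. Qed.

Lemma toR_le_sabs a : toR a <= sabs a.
Proof.
case: k a => /= [a|a]; first exact: ler_norm.
by apply: (le_trans (ler_norm _)); have := normc_ge_Re a; rewrite lecR.
Qed.

Definition sconj : K -> K :=
  match k return scalars R k -> scalars R k with
  | RealScalars => fun x => x | ComplexScalars => fun x => conjc x end.

Lemma sconjM a b : sconj (a * b) = sconj a * sconj b.
Proof. by rewrite /sconj; case: k a b => // a b; rewrite rmorphM. Qed.

Lemma sconjD a b : sconj (a + b) = sconj a + sconj b.
Proof. by rewrite /sconj; case: k a b => // a b; rewrite rmorphD. Qed.

Lemma sconjN a : sconj (- a) = - sconj a.
Proof. by rewrite /sconj; case: k a => // a; rewrite rmorphN. Qed.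

Lemma sconjK a : sconj (sconj a) = a.
Proof. by rewrite /sconj; case: k a => // a; rewrite conjcK. Qed.

Lemma mul_sconj a : a * sconj a = ofR k (sabs a ^+ 2).
Proof.
rewrite /sconj; case: k a => /= [a|[x y]]; first by rewrite real_normK ?num_real// expr2.
rewrite sqr_sqrtr ?addr_ge0 ?sqr_ge0//; apply/eqP; rewrite eq_complex /=.
by apply/andP; split; apply/eqP; ring.
Qed.

(** The rows (a, b) and (- conj b, conj a) form a multiple of a unitary matrix. *)
Lemma sabs_rotate a b c d :
  sabs (c * a - d * sconj b) ^+ 2 + sabs (c * b + d * sconj a) ^+ 2 =
  (sabs c ^+ 2 + sabs d ^+ 2) * (sabs a ^+ 2 + sabs b ^+ 2).
Proof.
apply: (@ofR_inj _ k); rewrite ofRM !ofRD -!mul_sconj.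
rewrite !sconjD sconjN !sconjM !sconjK; ring.
Qed.

Lemma sabs_parallelogram a b :
  sabs (a + b) ^+ 2 + sabs (a - b) ^+ 2 = 2 * (sabs a ^+ 2 + sabs b ^+ 2).
Proof.
have := @sabs_rotate 1 1 a (- b).
rewrite -[sconj 1]mulr1 [sconj 1 * 1]mulrC mul_sconj sabs1 expr1n ofR1 !mulr1 sabsN.
by rewrite opprK mulrC => ->.
Qed.

End Scalars.

(** * The Hahn-Banach theorem *)

Section HahnBanach.
Context (R : realType) (k : scalar_kind).
Local Notation K := (scalars R k).
Context (T : lmodType K).
Implicit Types (q : T -> R) (x y w : T) (r t : R).

Definition sublinear q :=
  (forall x y, q (x + y) <= q x + q y) /\
  (forall r x, 0 < r -> q (ofR k r *: x) <= r * q x).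

Lemma sublinear0 q : sublinear q -> q 0 = 0.
Proof.
move=> [qD qZ]; have h1 := qD 0 0.
have h2 := qZ 2^-1 0; rewrite scaler0 invr_gt0 ltr0n in h2.
by move: h1 (h2 isT); rewrite addr0; set z := q _; lra.
Qed.

Lemma sublinearN q x : sublinear q -> - q (- x) <= q x.
Proof.
move=> sq; have := sublinear0 sq; have := sq.1 x (- x); rewrite subrr.
by move=> ? ?; lra.
Qed.

Lemma sublinearZ q r x : sublinear q -> 0 <= r -> q (ofR k r *: x) = r * q x.
Proof.
move=> sq; rewrite le_eqVlt => /predU1P[<-|r0].
  by rewrite ofR0 scale0r mul0r sublinear0.
apply/le_anti; rewrite sq.2//=.
have rV : 0 < r^-1 by rewrite invr_gt0.
have := sq.2 r^-1 (ofR k r *: x) rV.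
by rewrite scalerA -ofRM mulVf ?gt_eqF// ofR1 scale1r ler_pdivlMl.
Qed.

(** Take q' x = inf over t >= 0 of q (x + t w) - t q w: the value t = 0 gives q' <= q,
the value t = 1 gives the bound at - w, and - q (- x) is a lower bound because
q (t w) <= q (x + t w) + q (- x). *)
Lemma sublinear_lower q w : sublinear q -> exists q',
  [/\ sublinear q', forall x, q' x <= q x & q' (- w) <= - q w].
Proof.
move=> sq; pose S x : set R :=
  [set q (x + ofR k t *: w) - t * q w | t in [set t : R | 0 <= t]].
have Sl x : lbound (S x) (- q (- x)).
  move=> _ [t /= t0 <-]; rewrite lerBrDr -sublinearZ//.
  by have := sq.1 (x + ofR k t *: w) (- x); rewrite addrAC subrr add0r; lra.
have Sx x t : 0 <= t -> inf (S x) <= q (x + ofR k t *: w) - t * q w.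
  by move=> t0; apply: ge_inf; [exists (- q (- x)); exact: Sl|exists t].
have S0 x : S x !=set0.
  by exists (q (x + ofR k 0 *: w) - 0 * q w), 0 => /=.
exists (fun x => inf (S x)); split.
- split=> [x y|r x r0].
    rewrite -lerBlDr; apply: lb_le_inf => // _ [s /= s0 <-].
    rewrite lerBlDr -lerBlDl; apply: lb_le_inf => // _ [t /= t0 <-].
    rewrite lerBlDl; apply: (le_trans (@Sx _ (s + t) (addr_ge0 s0 t0))).
    have := sq.1 (x + ofR k s *: w) (y + ofR k t *: w).
    by rewrite addrACA -scalerDl -ofRD; lra.
  rewrite -ler_pdivrMl//; apply: lb_le_inf => // _ [t /= t0 <-].
  rewrite ler_pdivrMl//; apply: (le_trans (@Sx _ (r * t) _)).
    by rewrite mulr_ge0// ltW.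
  by rewrite ofRM -scalerA -scalerDr sublinearZ// ?(ltW r0)// mulrBr mulrA.
- move=> x; apply: (le_trans (@Sx x 0 _)) => //.
  by rewrite ofR0 scale0r addr0 mul0r subr0.
- apply: (le_trans (@Sx (- w) 1 ler01)).
  by rewrite ofR1 scale1r addNr sublinear0// mul1r sub0r.
Qed.

(** By Zorn's lemma: the pointwise infimum over a chain is finite, as - q0 (- x) bounds
it below, and it is subadditive because of two members of the chain the smaller one
can be used at both summands. *)
Lemma sublinear_minimal q0 : sublinear q0 -> exists q,
  [/\ sublinear q, forall x, q x <= q0 x &
      forall q', sublinear q' -> (forall x, q' x <= q x) -> q' = q].
Proof.
move=> sq0.
pose P (q : T -> R) := sublinear q /\ forall x, q x <= q0 x.
pose Q := {q : T -> R | P q}.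
pose below (q1 q2 : Q) : bool := `[< forall x, sval q2 x <= sval q1 x >].
have [q qmin] : exists q : Q, forall q' : Q, below q q' -> q' = q.
  apply: Zorn.
  - by move=> q; apply/asboolP.
  - move=> q1 q2 q3 /asboolP h1 /asboolP h2; apply/asboolP => x.
    exact: le_trans (h2 x) (h1 x).
  - move=> [q1 P1] [q2 P2] /asboolP h1 /asboolP h2; apply: eq_exist.
    by apply/funext => x; apply/le_anti; rewrite h1 h2.
  move=> A Atot; have [[a Aa]|A0] := pselect (exists a, A a); last first.
    exists (exist P q0 (conj sq0 (fun x => lexx (q0 x)))) => s As.
    by case: A0; exists s.
  pose S x : set R := [set sval q x | q in A].
  have Sx x (q : Q) : A q -> inf (S x) <= sval q x.
    move=> Aq; apply: ge_inf; last by exists q.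
    exists (- q0 (- x)) => _ [[q1 [sq1 q1q0]] _ <-] /=.
    by apply: le_trans (sublinearN x sq1); rewrite lerN2.
  have S0 x : S x !=set0 by exists (sval a x); exists a.
  have sS : sublinear (fun x => inf (S x)).
    split=> [x y|r x r0].
      rewrite -lerBlDr; apply: lb_le_inf => // _ [q1 A1 <-].
      rewrite lerBlDr -lerBlDl; apply: lb_le_inf => // _ [q2 A2 <-].
      rewrite lerBlDl.
      have [/asboolP h|/asboolP h] := Atot _ _ A1 A2.
        apply: (le_trans (Sx _ _ A2)); apply: (le_trans ((svalP q2).1.1 _ _)).
        by rewrite lerD2r.
      apply: (le_trans (Sx _ _ A1)); apply: (le_trans ((svalP q1).1.1 _ _)).
      by rewrite lerD2l.
    rewrite -ler_pdivrMl//; apply: lb_le_inf => // _ [q1 A1 <-].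
    rewrite ler_pdivrMl//; apply: (le_trans (Sx _ _ A1)).
    exact: (svalP q1).1.2.
  have Sq0 x : inf (S x) <= q0 x by apply: (le_trans (Sx _ _ Aa)); exact: (svalP a).2.
  by exists (exist P _ (conj sS Sq0)) => q Aq; apply/asboolP => x /=; exact: Sx.
case: q qmin => [q [sq qq0]] qmin; exists q; split=> // q' sq' q'q.
have q'q0 x : q' x <= q0 x := le_trans (q'q x) (qq0 x).
have := qmin (exist P q' (conj sq' q'q0)) => /(_ _)/(congr1 sval)/= -> //.
by apply/asboolP.
Qed.

Definition real_linear q :=
  (forall x y, q (x + y) = q x + q y) /\ (forall r x, q (ofR k r *: x) = r * q x).

(** By sublinear_lower, minimality forces q (- w) <= - q w for every w, the converse of
what subadditivity gives; and an odd subadditive functional is additive. *)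
Lemma sublinear_minimal_linear q : sublinear q ->
  (forall q', sublinear q' -> (forall x, q' x <= q x) -> q' = q) -> real_linear q.
Proof.
move=> sq qmin.
have qN x : q (- x) = - q x.
  apply/le_anti/andP; split.
    by have [q' [sq' q'q]] := sublinear_lower x sq; rewrite (qmin q').
  by have := sublinearN x sq; lra.
split=> [x y|r x].
  apply/le_anti; rewrite sq.1/=.
  by have := sq.1 (x + y) (- y); rewrite addrK qN; lra.
have [r0|r0] := leP 0 r; first exact: sublinearZ.
have r0' : 0 <= - r by lra.
have e : ofR k r = - ofR k (- r).
  by rewrite -[RHS]add0r -(@ofR0 R k); apply/eqP; rewrite eq_sym subr_eq -ofRD subrr.
by rewrite e scaleNr qN sublinearZ// mulNr opprK.
Qed.

Lemma real_hahn_banach q w : sublinear q -> exists f,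
  [/\ real_linear f, forall x, f x <= q x & q w <= f w].
Proof.
move=> sq; have [q1 [sq1 q1q q1w]] := sublinear_lower w sq.
have [f [sf fq1 fmin]] := sublinear_minimal sq1.
exists f; split; first exact: sublinear_minimal_linear.
  by move=> x; exact: le_trans (fq1 x) (q1q x).
have := sublinearN w sf; apply: le_trans.
by have := fq1 (- w); lra.
Qed.

End HahnBanach.

(** A real-linear functional f is the real part of the K-linear functional
x |-> f x - i f (i x). *)
Lemma real_linear_complexify (R : realType) (k : scalar_kind)
    (T : lmodType (scalars R k)) (f : T -> R) : real_linear f ->
  exists F : T -> (scalars R k)^o, linear F /\ forall x, toR (F x) = f x.
Proof.
case: k T f => T f [fD fZ].
  by exists f; split=> // a x y; rewrite fD fZ.
have fN x : f (- x) = - f x.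
  by rewrite -scaleN1r (_ : -1 = ofR ComplexScalars (-1 : R)) ?fZ ?mulN1r//= rmorphN1.
pose F x : R[i]^o := (f x)%:C%C - 'i%C * (f ('i%C *: x))%:C%C.
have ii : 'i%C * 'i%C = -1 :> R[i] by rewrite -expr2 sqr_i.
have FD x y : F (x + y) = F x + F y.
  by rewrite /F scalerDr !fD !rmorphD/= mulrDr opprD addrACA.
have FZ (r : R) x : F (r%:C%C *: x) = r%:C%C * F x.
  rewrite /F scalerA ['i%C * r%:C%C]mulrC -scalerA !(fZ r) !rmorphM/= mulrBr.
  by congr (_ - _); rewrite mulrCA.
have Fi x : F ('i%C *: x) = 'i%C * F x.
  rewrite /F scalerA ii scaleN1r fN rmorphN/= mulrN opprK mulrBr mulrA ii.
  by rewrite mulN1r opprK addrC.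
exists F; split=> [[a b] x y|x]; last first.
  by rewrite /= !(mul0r, mul1r, mulr0, subr0, oppr0, addr0).
have e : (a +i* b)%C = a%:C%C + 'i%C * b%:C%C :> R[i].
  apply/eqP; rewrite eq_complex /=.
  by rewrite !(mul0r, mul1r, mulr0, subr0, oppr0, addr0, add0r, eqxx).
by rewrite FD e scalerDl FD -scalerA Fi !FZ mulrA -mulrDl.
Qed.

(** The two conclusions together force F w = p w. Seminorms are allowed so that the
distance to a subspace can be taken for p. Multiplying x by a scalar of modulus 1 that
makes F x nonnegative turns the bound on the real part of F into one on its modulus. *)
Theorem hahn_banach (R : realType) (k : scalar_kind) (T : lmodType (scalars R k))
    (p : seminorm T) (w : T) :
  exists F : {linear T -> (scalars R k)^o},
    (forall x, sabs (F x) <= p x) /\ p w <= toR (F w).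
Proof.
have sp : sublinear p.
  split=> [x y|r x r0]; first exact: seminormD.
  by rewrite seminormZ sabs_ofR // ltW.
have [f [lf fp wf]] := real_hahn_banach w sp.
have [F [lF Ff]] := real_linear_complexify lf.
pose F' : {linear T -> (scalars R k)^o} :=
  HB.pack F (GRing.isLinear.Build _ _ _ *:%R F lF).
exists F'; split=> [x|/=]; last by rewrite Ff.
have FZ a y : F' (a *: y) = a * F' y by rewrite linearZ.
have [->|Fx0] := eqVneq (F' x) 0; first by rewrite sabs0 seminorm_ge0.
pose a : scalars R k := `|F' x| / F' x.
have a1 : sabs a = 1.
  by rewrite /a normrM normfV normr_id mulfV ?normr_eq0// -(@ofR1 R k) ofRK.
have -> : sabs (F' x) = toR (F' (a *: x)) by rewrite FZ /a divfK.
by rewrite /= Ff; apply: (le_trans (fp _)); rewrite seminormZ a1 mul1r.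
Qed.

(** * Functionals and operators on normed spaces *)

Section Norming.
Context (R : realType) (k : scalar_kind).
Local Notation K := (scalars R k).

Definition norm_seminorm (X : normedModType K) : seminorm X :=
  @Seminorm R k X (@rnorm R k X) (@rnormD R k X) (@rnormZ R k X).

Lemma norming_functional (X : normedModType K) (w : X) :
  exists F : {linear X -> K^o},
    (forall x, sabs (F x) <= rnorm x) /\ rnorm w <= toR (F w).
Proof. exact: (hahn_banach (norm_seminorm X) w). Qed.

Lemma rnormN (X : normedModType K) (x : X) : rnorm (- x) = rnorm x.
Proof. by rewrite /rnorm normrN. Qed.

Lemma rnorm_gt0 (X : normedModType K) (x : X) : (0 < rnorm x) = (x != 0).
Proof.
rewrite lt_neqAle rnorm_ge0 andbT eq_sym; apply/idP/idP; apply: contra => /eqP.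
  by move=> ->; rewrite rnorm0.
by move=> x0; apply/eqP; exact: rnorm0_eq0.
Qed.

Lemma boundedOpD (X Y : normedModType K) (A B : boundedOp X Y) x :
  (A + B) x = A x + B x.
Proof. by []. Qed.

Lemma boundedOpB (X Y : normedModType K) (A B : boundedOp X Y) x :
  (A - B) x = A x - B x.
Proof. by []. Qed.

Lemma opnorm_ge0 (X Y : normedModType K) (A : boundedOp X Y) : 0 <= opnorm A.
Proof. by rewrite -rnorm_boundedOp rnorm_ge0. Qed.

Lemma opnorm_le_bound (X Y : normedModType K) (A : boundedOp X Y) (M : R) :
  0 <= M -> (forall x, rnorm (A x) <= M * rnorm x) -> opnorm A <= M.
Proof.
move=> M0 AM; apply: opnorm_le => x x1; apply: (le_trans (AM x)).
by rewrite -[leRHS]mulr1 ler_wpM2l.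
Qed.

Lemma bounded_op (X Y : normedModType K) (f : {linear X -> Y}) (M : R) :
  0 <= M -> (forall x, rnorm (f x) <= M * rnorm x) ->
  exists A : boundedOp X Y, (forall x, A x = f x) /\ opnorm A <= M.
Proof.
move=> M0 fM; have Af : (f : X -> Y) \in @bounded_linear R k X Y.
  by apply/asboolP; split; [exact: linearP|exists M].
by exists (BoundedOp Af); split=> //; exact: opnorm_le_bound.
Qed.

End Norming.

(** * Bilinear forms and the projective norm *)

Lemma quadratic_bound (R : realFieldType) (C a b P Q s t : R) :
  0 <= P -> 0 <= Q -> 0 <= s -> 0 <= t -> 0 <= C ->
  a ^+ 2 + b ^+ 2 <= P * s + Q * t -> P ^+ 2 + Q ^+ 2 <= C * (a ^+ 2 + b ^+ 2) ->
  a ^+ 2 + b ^+ 2 <= C * (s ^+ 2 + t ^+ 2).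
Proof.
move=> P0 Q0 s0 t0 C0 key hPQ.
have ab0 : 0 <= a ^+ 2 + b ^+ 2 by rewrite addr_ge0// sqr_ge0.
have st0 : 0 <= s ^+ 2 + t ^+ 2 by rewrite addr_ge0// sqr_ge0.
move: ab0; rewrite le_eqVlt => /predU1P[<-|ab0]; first exact: mulr_ge0.
rewrite -(ler_pM2l ab0) mulrA [_ * C]mulrC.
have CS : (P * s + Q * t) ^+ 2 <= (P ^+ 2 + Q ^+ 2) * (s ^+ 2 + t ^+ 2).
  by rewrite -subr_ge0 (_ : _ - _ = (P * t - Q * s) ^+ 2) ?sqr_ge0//; ring.
apply: le_trans (ler_wpM2r st0 hPQ); apply: le_trans CS.
by rewrite -expr2 lerXn2r// nnegrE ?(ltW ab0)// addr_ge0// mulr_ge0.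
Qed.

Section TensorForms.
Context (R : realType) (k : scalar_kind).
Local Notation K := (scalars R k).
Context (X Y : normedModType K).

(** The bound is additive along a representation of w, and the projective norm is the
infimum of the costs of the representations. *)
Lemma tensor_form_bound (H : {linear tensor X Y -> K^o}) (M : R) (w : tensor X Y) :
  0 <= M -> (forall x y, sabs (H (tens x y)) <= M * (rnorm x * rnorm y)) ->
  sabs (H w) <= M * proj_norm w.
Proof.
move=> M0 HM.
have cost s : sabs (H (\sum_(q <- s) tens q.1 q.2)) <= M * proj_cost s.
  rewrite linear_sum /proj_cost mulr_sumr.
  elim: s => [|q s ih]; first by rewrite !big_nil sabs0.
  by rewrite !big_cons (le_trans (sabsD _ _))// lerD.
move: M0; rewrite le_eqVlt => /predU1P[M0|M0].
  have [s ws] := tensor_sumP w.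
  by have := cost s; rewrite -ws -M0 !mul0r.
by rewrite -ler_pdivrMl//; apply: proj_norm_ge => s ->; rewrite ler_pdivrMl.
Qed.

(** A functional known to be continuous, with an arbitrary constant N, inherits the
constant M from the dense image of the algebraic tensor product. *)
Lemma proj_tensor_form_bound (H : {linear proj_tensor X Y -> K^o}) (M N : R) u :
  0 <= M -> (forall u, sabs (H u) <= N * rnorm u) ->
  (forall x y, sabs (H (completion_in _ (tens x y))) <= M * (rnorm x * rnorm y)) ->
  sabs (H u) <= M * rnorm u.
Proof.
move=> M0 HN HM; apply/ler_addgt0Pr => e e0.
have N0 : 0 < `|N| + M + 1 by rewrite ltr_wpDl// addr_ge0.
have [t] := completion_in_dense u (divr_gt0 e0 N0).
rewrite ltr_pdivlMr//; set ut := u - _ => ute.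
pose G : {linear tensor X Y -> K^o} := H \o completion_in (proj_seminorm X Y).
have Ht : sabs (H (u - ut)) <= M * rnorm (u - ut).
  rewrite /ut opprB addrC subrK rnorm_completion_in.
  exact: (@tensor_form_bound G M t M0 HM).
have hu : sabs (H u) <= sabs (H (u - ut)) + sabs (H ut).
  by have := sabsD (H (u - ut)) (H ut); rewrite -[H (u - ut) + _]linearD subrK.
have hut := HN ut.
have hN : N * rnorm ut <= `|N| * rnorm ut by rewrite ler_wpM2r ?rnorm_ge0 ?ler_norm.
have hM : M * rnorm (u - ut) <= M * rnorm u + M * rnorm ut.
  by rewrite -mulrDr ler_wpM2l// (le_trans (rnormD _ _))// rnormN.
have r0 := rnorm_ge0 ut.
by rewrite !mulrDr mulr1 [_ * `|N|]mulrC [_ * M]mulrC in ute; lra.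
Qed.

Lemma rnorm_tens_le x y :
  rnorm (completion_in (proj_seminorm X Y) (tens x y)) <= rnorm x * rnorm y.
Proof.
rewrite rnorm_completion_in; have := proj_norm_le [:: (x, y)].
by rewrite /proj_cost !big_seq1.
Qed.

Definition op_form (A : boundedOp X (dual Y)) (x : X) (y : Y) : K :=
  (A x : boundedOp Y K^o) y.

Lemma op_formD A B x y : op_form (A + B) x y = op_form A x y + op_form B x y.
Proof. by rewrite /op_form boundedOpD; exact: boundedOpD. Qed.

Lemma op_formB A B x y : op_form (A - B) x y = op_form A x y - op_form B x y.
Proof. by rewrite /op_form boundedOpB; exact: boundedOpB. Qed.

Lemma op_form_bound (A : boundedOp X (dual Y)) x y :
  sabs (op_form A x y) <= opnorm A * (rnorm x * rnorm y).
Proof.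
apply: (le_trans (le_opnorm (A x : boundedOp Y K^o) y)).
by rewrite mulrA ler_wpM2r ?rnorm_ge0// -rnorm_boundedOp; exact: le_opnorm.
Qed.

(** With op_form_bound and proj_tensor_form_bound, this identifies the dual of the
projective tensor product with the operators from X to the dual of Y. *)
Lemma form_operator (H : {linear proj_tensor X Y -> K^o}) (M : R) :
  0 <= M -> (forall u, sabs (H u) <= M * rnorm u) ->
  exists A : boundedOp X (dual Y), opnorm A <= M /\
    forall x y, op_form A x y = H (completion_in _ (tens x y)).
Proof.
move=> M0 HM; pose h x y : K^o := H (completion_in (proj_seminorm X Y) (tens x y)).
have hM x y : sabs (h x y) <= M * rnorm x * rnorm y.
  by apply: (le_trans (HM _)); rewrite -mulrA ler_wpM2l// rnorm_tens_le.
have hx x : h x \in @bounded_linear R k Y K^o.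
  apply/asboolP; split; last by exists (M * rnorm x); exact: hM.
  by move=> a y z; rewrite /h linearPr !linearP.
pose hop x : dual Y := BoundedOp (hx x).
have hopP : hop \in @bounded_linear R k X (dual Y).
  apply/asboolP; split.
    move=> a x z; apply/val_inj/funext => y /=.
    by rewrite /h linearPl !linearP.
  exists M => x; rewrite rnorm_boundedOp; apply: opnorm_le_bound; last exact: hM.
  by rewrite mulr_ge0// rnorm_ge0.
exists (BoundedOp hopP); split=> //; apply: opnorm_le_bound => // x.
rewrite rnorm_boundedOp; apply: opnorm_le_bound; last exact: hM.
by rewrite mulr_ge0// rnorm_ge0.
Qed.

(** The bound a^2 + b^2 <= |aF + bG| |u| + |aF - bG| |v|, where F and G norm u + v and
u - v, is combined with the hypothesis for aF and bG, whose norms are at most a and b. *)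
Lemma proj_tensor_parallelogram (C : R) (u v : proj_tensor X Y) : 0 <= C ->
  (forall A B : boundedOp X (dual Y), opnorm (A + B) ^+ 2 + opnorm (A - B) ^+ 2 <=
     C * (opnorm A ^+ 2 + opnorm B ^+ 2)) ->
  rnorm (u + v) ^+ 2 + rnorm (u - v) ^+ 2 <= C * (rnorm u ^+ 2 + rnorm v ^+ 2).
Proof.
move=> C0 hC; set a := rnorm (u + v); set b := rnorm (u - v).
have a0 : 0 <= a := rnorm_ge0 _; have b0 : 0 <= b := rnorm_ge0 _.
have [F [F1 Fa]] := norming_functional (u + v).
have [G [G1 Gb]] := norming_functional (u - v).
pose aF : {linear proj_tensor X Y -> K^o} := ofR k a \*: F.
pose bG : {linear proj_tensor X Y -> K^o} := ofR k b \*: G.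
have aFM w : sabs (aF w) <= a * rnorm w.
  by rewrite /= sabsM sabs_ofR// ler_wpM2l.
have bGM w : sabs (bG w) <= b * rnorm w.
  by rewrite /= sabsM sabs_ofR// ler_wpM2l.
have [A [Aa AF]] := form_operator a0 aFM.
have [B [Bb BG]] := form_operator b0 bGM.
have hu : sabs (aF u + bG u) <= opnorm (A + B) * rnorm u.
  pose H : {linear proj_tensor X Y -> K^o} := aF \+ bG.
  apply: (@proj_tensor_form_bound H _ (a + b)); first exact: opnorm_ge0.
    by move=> w; rewrite mulrDl (le_trans (sabsD _ _))// lerD.
  move=> x y; apply: le_trans (op_form_bound (A + B) x y).
  by rewrite op_formD AF BG.
have hv : sabs (aF v - bG v) <= opnorm (A - B) * rnorm v.
  pose H : {linear proj_tensor X Y -> K^o} := aF \- bG.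
  apply: (@proj_tensor_form_bound H _ (a + b)); first exact: opnorm_ge0.
    by move=> w; rewrite mulrDl (le_trans (sabsD _ _))// lerD ?sabsN.
  move=> x y; apply: le_trans (op_form_bound (A - B) x y).
  by rewrite op_formB AF BG.
have key : a ^+ 2 + b ^+ 2 <= opnorm (A + B) * rnorm u + opnorm (A - B) * rnorm v.
  apply: (@le_trans _ _ (a * toR (F (u + v)) + b * toR (G (u - v)))).
    by rewrite !expr2 lerD// ler_wpM2l.
  have -> : a * toR (F (u + v)) + b * toR (G (u - v)) =
      toR (aF u + bG u + (aF v - bG v) : K).
    rewrite -(toRZ a (F (u + v))) -(toRZ b (G (u - v))) -toRD /= !linearD !linearN /=.
    by rewrite addrACA -!scalerBr -!scalerDr.
  by apply: (le_trans (toR_le_sabs _)); apply: le_trans (lerD hu hv); exact: sabsD.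
apply: quadratic_bound key _; rewrite ?opnorm_ge0 ?rnorm_ge0//.
apply: (le_trans (hC A B)); rewrite ler_wpM2l// lerD//.
  by apply: lerXn2r Aa; rewrite nnegrE// opnorm_ge0.
by apply: lerXn2r Bb; rewrite nnegrE// opnorm_ge0.
Qed.

Lemma bilinear_tensor_form (h : X -> Y -> K^o) : bilinear_for *:%R *:%R h ->
  exists H : {linear tensor X Y -> K^o}, forall x y, H (tens x y) = h x y.
Proof.
move=> hP.
pose b : {bilinear X -> Y -> K^o} :=
  HB.pack h (bilinear_isBilinear.Build K X Y K^o *:%R *:%R h hP).
pose H : {linear tensor X Y -> K^o} :=
  HB.pack (tensor_lift b) (GRing.isLinear.Build _ _ _ *:%R _ (tensor_lift_linear b)).
by exists H => x y; exact: tensor_lift_tens.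
Qed.

(** Bounded bilinear forms give lower bounds for the projective norm; in particular
they survive in the completion. *)
Lemma proj_norm_form_ge (h : X -> Y -> K^o) (M : R) (s : seq (X * Y)) :
  bilinear_for *:%R *:%R h -> 0 <= M ->
  (forall x y, sabs (h x y) <= M * (rnorm x * rnorm y)) ->
  sabs (\sum_(q <- s) h q.1 q.2) <=
    M * rnorm (completion_in (proj_seminorm X Y) (\sum_(q <- s) tens q.1 q.2)).
Proof.
move=> hP M0 hM; have [H Hh] := bilinear_tensor_form hP.
rewrite rnorm_completion_in (eq_bigr (fun q => H (tens q.1 q.2))) => [|q _]; last first.
  by rewrite Hh.
by rewrite -linear_sum; apply: tensor_form_bound => // x y; rewrite Hh.
Qed.

(** The product of two norming functionals is a form of norm 1 attaining the value. *)
Lemma rnorm_tens x y :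
  rnorm (completion_in (proj_seminorm X Y) (tens x y)) = rnorm x * rnorm y.
Proof.
apply/le_anti; rewrite rnorm_tens_le/=.
have [F [F1 Fx]] := norming_functional x; have [G [G1 Gy]] := norming_functional y.
pose h x y : K^o := F x * G y.
have hP : bilinear_for *:%R *:%R h.
  split=> [w a z t|w a z t]; rewrite /h linearP.
    by rewrite [LHS]mulrDl -[_ *: F z]/(a * F z) -mulrA.
  by rewrite [LHS]mulrDr -[_ *: G z]/(a * G z) mulrCA.
have hM z w : sabs (h z w) <= 1 * (rnorm z * rnorm w).
  by rewrite mul1r sabsM ler_pM// sabs_ge0.
have := proj_norm_form_ge [:: (x, y)] hP ler01 hM; rewrite !big_seq1 mul1r.
apply: le_trans; rewrite /= sabsM ler_pM ?rnorm_ge0//.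
  exact: le_trans (toR_le_sabs _).
exact: le_trans (toR_le_sabs _).
Qed.

End TensorForms.

(** * Planes and the Banach-Mazur distance *)

Section Planes.
Context (R : realType) (k : scalar_kind).
Local Notation K := (scalars R k).

Lemma ell22_sqnorm (v : ell22 R k) :
  rnorm v ^+ 2 = sabs ((v : 'rV[K]_2) ord0 ord0) ^+ 2 +
                 sabs ((v : 'rV[K]_2) ord0 (lift ord0 ord0)) ^+ 2.
Proof.
rewrite (_ : rnorm v = ell22_norm v); last exact: ofRK.
rewrite sqr_sqrtr ?sumr_ge0// => [|i _]; last exact: sqr_ge0.
by rewrite big_ord_recl big_ord1.
Qed.

Lemma ell22_parallelogram (u v : ell22 R k) :
  rnorm (u + v) ^+ 2 + rnorm (u - v) ^+ 2 = 2 * (rnorm u ^+ 2 + rnorm v ^+ 2).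
Proof.
rewrite !ell22_sqnorm !mxE addrACA !sabs_parallelogram; ring.
Qed.

Lemma banach_mazur_ge1 (E F : normedModType K) :
  (exists x : E, x != 0) -> (1 <= banach_mazur E F)%E.
Proof.
move=> [x x0]; apply: le_ereal_inf_tmp => _ [T [S [TS _ ->]]]; rewrite lee_fin.
have x1 : 0 < rnorm x by rewrite rnorm_gt0.
rewrite -(ler_pM2r x1) mul1r -{1}(TS x) [_ * opnorm S]mulrC -mulrA.
apply: (le_trans (le_opnorm S _)); rewrite ler_wpM2l ?opnorm_ge0//.
exact: le_opnorm.
Qed.

(** The parallelogram law of the Euclidean plane is transported by an isomorphism of
distortion at most d, for each d > c, and d then tends to c. *)
Lemma banach_mazur_parallelogram (E : normedModType K) (c : R) (x y : E) :
  0 <= c -> (banach_mazur E (ell22 R k) <= c%:E)%E ->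
  rnorm (x + y) ^+ 2 + rnorm (x - y) ^+ 2 <=
    2 * c ^+ 2 * (rnorm x ^+ 2 + rnorm y ^+ 2).
Proof.
move=> c0 Ec; set N := _ + _; set M := rnorm x ^+ 2 + _.
have N0 : 0 <= N by rewrite addr_ge0// sqr_ge0.
have M0 : 0 <= M by rewrite addr_ge0// sqr_ge0.
have h d : c < d -> N <= 2 * d ^+ 2 * M.
  move=> cd; have : (banach_mazur E (ell22 R k) < d%:E)%E by exact: le_lt_trans Ec _.
  move=> /ereal_inf_lt[_ [T [S [TS _ ->]]]]; rewrite lte_fin => TSd.
  have Sn u : rnorm (S u) ^+ 2 <= opnorm S ^+ 2 * rnorm u ^+ 2.
    rewrite -exprMn lerXn2r ?nnegrE ?mulr_ge0 ?rnorm_ge0 ?opnorm_ge0//; exact: le_opnorm.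
  have Tn u : rnorm (T u) ^+ 2 <= opnorm T ^+ 2 * rnorm u ^+ 2.
    rewrite -exprMn lerXn2r ?nnegrE ?mulr_ge0 ?rnorm_ge0 ?opnorm_ge0//; exact: le_opnorm.
  apply: (@le_trans _ _
    (opnorm S ^+ 2 * (rnorm (T x + T y) ^+ 2 + rnorm (T x - T y) ^+ 2))).
    rewrite -linearD -linearB mulrDr.
    by rewrite /N -{1}(TS (x + y)) -{1}(TS (x - y)) lerD.
  rewrite ell22_parallelogram.
  apply: (@le_trans _ _ (opnorm S ^+ 2 * (2 * (opnorm T ^+ 2 * M)))).
    by rewrite !ler_wpM2l ?sqr_ge0// mulrDr lerD.
  rewrite (_ : _ * _ = 2 * (opnorm T * opnorm S) ^+ 2 * M); last by ring.
  rewrite ler_wpM2r// ler_wpM2l// lerXn2r ?nnegrE ?mulr_ge0 ?opnorm_ge0// ltW//.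
  exact: le_lt_trans c0 cd.
move: M0; rewrite le_eqVlt => /predU1P[M0|M0].
  by have := h (c + 1); rewrite -M0 !mulr0; apply; rewrite ltrDl.
have M20 : 0 < 2 * M by rewrite mulr_gt0.
have q0 : 0 <= N / (2 * M) by rewrite divr_ge0// ltW.
suff : Num.sqrt (N / (2 * M)) <= c.
  rewrite -(@ler_pXn2r _ 2)// ?nnegrE ?sqrtr_ge0// sqr_sqrtr// ler_pdivrMr//.
  by rewrite mulrA [c ^+ 2 * 2]mulrC.
apply/ler_addgt0Pr => e e0; have ce : c < c + e by rewrite ltrDl.
have ce0 : 0 <= c + e by rewrite (le_trans c0)// ltW.
rewrite -(@ler_pXn2r _ 2)// ?nnegrE ?sqrtr_ge0// sqr_sqrtr// ler_pdivrMr//.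
by rewrite mulrA [_ * 2]mulrC h.
Qed.

Section Span.
Context (V : normedModType K).
Implicit Types (x y z : V).

Definition lin_indep2 x y := forall a b : K, a *: x + b *: y = 0 -> a = 0 /\ b = 0.

Definition span2 x y : {pred V} :=
  [pred z | `[< exists a b : K, z = a *: x + b *: y >]].

Lemma span2_submod_closed x y : submod_closed (span2 x y).
Proof.
split; first by apply/asboolP; exists 0, 0; rewrite !scale0r addr0.
move=> c _ _ /asboolP[a [b ->]] /asboolP[a' [b' ->]]; apply/asboolP.
exists (c * a + a'), (c * b + b').
by rewrite scalerDr !scalerDl !scalerA addrACA.
Qed.

HB.instance Definition _ x y := GRing.isSubmodClosed.Build K V
  (span2 x y) (span2_submod_closed x y).

Lemma span2_dim x y : lin_indep2 x y -> has_dim (subspaceOf (span2 x y)) 2.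
Proof.
move=> xy.
have mx : x \in span2 x y by apply/asboolP; exists 1, 0; rewrite scale1r scale0r addr0.
have my : y \in span2 x y by apply/asboolP; exists 0, 1; rewrite scale1r scale0r add0r.
exists (fun i => if i == ord0 then SubspaceOf mx else SubspaceOf my) => -[v mv].
have /asboolP[a [b e]] := mv.
exists [ffun i : 'I_2 => if i == ord0 then a else b]; split.
  by apply: val_inj; rewrite big_ord_recl big_ord1 !ffunE.
move=> c /(congr1 val); rewrite /= big_ord_recl big_ord1 /= e.
move=> /eqP; rewrite -subr_eq0 opprD addrACA -!scalerBl => /eqP/xy[].
move=> /eqP; rewrite subr_eq0 => /eqP ea /eqP; rewrite subr_eq0 => /eqP eb.
apply/ffunP => i; rewrite ffunE; case: ifPn => [/eqP->//|].
case: i => -[//|[|//]] ? _; rewrite eb; congr (c _); exact: val_inj.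
Qed.

Lemma lin_dep2 x y : (exists z, z <> 0) -> ~ lin_indep2 x y ->
  exists z c d, [/\ z <> 0, x = c *: z & y = d *: z].
Proof.
move=> [z0 z00] nxy; have [x0|/eqP x0] := eqVneq x 0; last first.
  exists x; apply: contrapT => h; apply: nxy => a b e.
  have b0 : b = 0.
    apply: contrapT => /eqP b0; apply: h; exists 1, (- (b^-1 * a)); split=> //.
      by rewrite scale1r.
    rewrite scaleNr; apply: (scalerI b0); rewrite scalerN scalerA mulrA mulfV// mul1r.
    by apply/eqP; rewrite -subr_eq0 opprK addrC e.
  split=> //; move: e; rewrite b0 scale0r addr0 => /eqP.
  by rewrite scaler_eq0 => /orP[/eqP//|/eqP].
have [y0|/eqP y0] := eqVneq y 0.
  by exists z0, 0, 0; rewrite scale0r.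
by exists y, 0, 1; rewrite scale0r scale1r.
Qed.

Lemma lin_indep2_exists x : x <> 0 -> ~ has_dim V 1 -> exists y, lin_indep2 x y.
Proof.
move=> x0 d1; suff [y xy] : exists y, forall c : K, y <> c *: x.
  exists y => a b e; have b0 : b = 0.
    apply: contrapT => /eqP b0; apply: (xy (- (b^-1 * a))).
    rewrite scaleNr; apply: (scalerI b0); rewrite scalerN scalerA mulrA mulfV// mul1r.
    by apply/eqP; rewrite -subr_eq0 opprK addrC e.
  split=> //; move: e; rewrite b0 scale0r addr0 => /eqP.
  by rewrite scaler_eq0 => /orP[/eqP//|/eqP].
apply: contrapT => h; apply: d1; exists (fun=> x) => v.
have [c vc] : exists c, v = c *: x.
  apply: contrapT => hv; apply: h; exists v => c vc; apply: hv; by exists c.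
exists [ffun=> c]; split; first by rewrite big_ord1 ffunE.
move=> c'; rewrite big_ord1 vc => /eqP; rewrite -subr_eq0 -scalerBl scaler_eq0.
move=> /orP[|/eqP//]; rewrite subr_eq0 => /eqP cc'; apply/ffunP => i.
by rewrite ffunE cc' (ord1 i).
Qed.

(** Dependent vectors lie on a line, which is contained in a plane. *)
Lemma span2_through x y : (exists z, z <> 0) -> ~ has_dim V 1 ->
  exists u v, [/\ lin_indep2 u v, x \in span2 u v & y \in span2 u v].
Proof.
move=> z0 d1; have [xy|xy] := pselect (lin_indep2 x y).
  exists x, y; split=> //; apply/asboolP.
    by exists 1, 0; rewrite scale1r scale0r addr0.
  by exists 0, 1; rewrite scale1r scale0r add0r.
have [z [c [d [zn0 -> ->]]]] := lin_dep2 z0 xy.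
have [v zv] := lin_indep2_exists zn0 d1.
by exists z, v; split=> //; apply/asboolP; [exists c, 0|exists d, 0];
  rewrite scale0r addr0.
Qed.

End Span.

Lemma has_dim2_basis (E : normedModType K) : has_dim E 2 ->
  exists x y : E, lin_indep2 x y /\ forall v, exists a b : K, v = a *: x + b *: y.
Proof.
move=> [e eP]; exists (e ord0), (e (lift ord0 ord0)); split=> [a b ab|v]; last first.
  have [c [-> _]] := eP v; exists (c ord0), (c (lift ord0 ord0)).
  by rewrite big_ord_recl big_ord1.
have [c [_ cu]] := eP 0.
have h0 : c = [ffun=> 0].
  by apply: cu; rewrite big1// => i _; rewrite ffunE scale0r.
have h1 : c = [ffun i => if i == ord0 then a else b].
  by apply: cu; rewrite big_ord_recl big_ord1 !ffunE.
by split; [have := congr1 (fun f : {ffun _} => f ord0) h1|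
  have := congr1 (fun f : {ffun _} => f (lift ord0 ord0)) h1]; rewrite h0 !ffunE.
Qed.

End Planes.

(** * John's theorem in dimension two *)

Section Stretching.
Context (R : realType) (k : scalar_kind).
Local Notation K := (scalars R k).

(** Such pairs are the images of the standard basis of ell_2^2 under contractions. *)
Definition contractive_pair (E : normedModType K) (x y : E) :=
  forall a b : K, rnorm (a *: x + b *: y) ^+ 2 <= sabs a ^+ 2 + sabs b ^+ 2.

Lemma contractive_pair_rotate (E : normedModType K) (x y : E) (a b : K) :
  contractive_pair x y -> sabs a ^+ 2 + sabs b ^+ 2 = 1 ->
  contractive_pair (a *: x + b *: y) (- sconj b *: x + sconj a *: y).
Proof.
move=> xy ab c d.
rewrite (_ : _ + _ = (c * a - d * sconj b) *: x + (c * b + d * sconj a) *: y).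
  by apply: (le_trans (xy _ _)); rewrite sabs_rotate ab mulr1.
by rewrite !scalerDr !scalerA addrACA -!scalerDl mulrN.
Qed.

(** In the coordinates given by x and y the unit ball contains the unit disc and the
points at distance t = sqrt (w^2 + 1) on the axis of x. Their convex hull contains the
ellipse of semi-axes al and al / w, which touches the tangents to the disc drawn from
these points. The product of its semi-axes is (w + 1 / w) / 2, larger than 1 as soon as
w > 1, that is, t > sqrt 2. *)
Lemma contractive_pair_stretch (E : normedModType K) (x y : E) (w al : R) :
  1 <= w -> 0 <= al -> al ^+ 2 = (w ^+ 2 + 1) / 2 ->
  contractive_pair x y -> (w ^+ 2 + 1) * rnorm x ^+ 2 <= 1 ->
  contractive_pair (ofR k al *: x) (ofR k (al / w) *: y).
Proof.
move=> w1 al0 al2 xy x1 c d; rewrite !scalerA.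
set r := sabs c; set q := sabs d.
have r0 : 0 <= r := sabs_ge0 _; have q0 : 0 <= q := sabs_ge0 _.
have w0 : 0 < w by apply: lt_le_trans w1.
have be0 : 0 <= al / w by rewrite divr_ge0// ltW.
(* Away from the axis of x the ellipse lies in the disc itself. *)
have [qr|rq] := leP (w * r) q.
  apply: (le_trans (xy _ _)); rewrite !sabsM !sabs_ofR// -/r -/q.
  rewrite !exprMn al2 exprVn.
  have wr : w ^+ 2 * r ^+ 2 <= q ^+ 2.
    by rewrite -exprMn lerXn2r// nnegrE// mulr_ge0// ltW.
  have w21 : 1 <= w ^+ 2 by rewrite expr_ge1// ltW.
  have w20 : 0 < w ^+ 2 by rewrite exprn_gt0.
  rewrite -(ler_pM2l w20) -subr_ge0.
  rewrite (_ : _ - _ = (w ^+ 2 - 1) * (q ^+ 2 - w ^+ 2 * r ^+ 2) / 2); last first.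
    by field; rewrite gt_eqF.
  by rewrite divr_ge0// mulr_ge0// subr_ge0.
set t := Num.sqrt (w ^+ 2 + 1).
have t2 : t ^+ 2 = w ^+ 2 + 1 by rewrite sqr_sqrtr// addr_ge0// sqr_ge0.
have t0 : 0 < t by rewrite sqrtr_gt0 ltr_wpDl// sqr_ge0.
have xt : rnorm x <= t^-1.
  rewrite -(@ler_pXn2r _ 2)// ?nnegrE ?rnorm_ge0 ?invr_ge0 ?(ltW t0)//.
  by rewrite exprVn t2 -[leRHS]mul1r ler_pdivlMr ?ltr_wpDl ?sqr_ge0// mulrC.
have r00 : 0 < r.
  by rewrite lt_neqAle r0 andbT; apply/eqP => e; move: rq; rewrite -e mulr0 ltNge q0.
(* Elsewhere, split the vector between the disc and the point at distance t: this la
   minimises the sum of the bounds for the two norms, which is then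
   al * (q + r) / t. *)
pose la := al * q / (w ^+ 2 * r).
have w20 : 0 < w ^+ 2 by rewrite exprn_gt0.
have la0 : 0 <= la by apply: divr_ge0; apply: mulr_ge0 => //; exact: ltW.
have laal : la <= al.
  rewrite /la ler_pdivrMr ?mulr_gt0 ?exprn_gt0// ler_wpM2l//.
  by apply: (le_trans (ltW rq)); rewrite ler_wpM2r// expr2 ler_peMl// (ltW w0).
rewrite (_ : _ + _ = ((c * ofR k la) *: x + (d * ofR k (al / w)) *: y) +
    (c * ofR k (al - la)) *: x); last first.
  by rewrite addrAC -scalerDl -mulrDr -ofRD [la + _]addrC subrK.
have h1 : rnorm ((c * ofR k la) *: x + (d * ofR k (al / w)) *: y) <= al * q * t / w ^+ 2.
  rewrite -(@ler_pXn2r _ 2)// ?nnegrE ?rnorm_ge0 ?divr_ge0 ?mulr_ge0 ?sqr_ge0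
    ?(ltW t0) ?(ltW w0)//.
  apply: (le_trans (xy _ _)); rewrite !sabsM !sabs_ofR// -/r -/q.
  rewrite le_eqVlt; apply/orP; left; apply/eqP.
  rewrite [RHS](_ : _ = al ^+ 2 * q ^+ 2 * t ^+ 2 / w ^+ 4); last first.
    by field; rewrite gt_eqF.
  by rewrite t2 /la; field; rewrite !gt_eqF.
have h2 : rnorm ((c * ofR k (al - la)) *: x) <= r * (al - la) / t.
  by rewrite rnormZ sabsM sabs_ofR ?subr_ge0// -/r ler_wpM2l// mulr_ge0// subr_ge0.
have h3 : al * q * t / w ^+ 2 + r * (al - la) / t = al * (q + r) / t.
  apply: (mulIf (lt0r_neq0 t0)); rewrite mulrDl !divfK ?gt_eqF//.
  rewrite (_ : al * q * t / w ^+ 2 * t = al * q * t ^+ 2 / w ^+ 2).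
    by rewrite t2 /la; field; rewrite !gt_eqF.
  by field; rewrite gt_eqF.
have h4 : 0 <= al * (q + r) / t by rewrite divr_ge0 ?mulr_ge0 ?addr_ge0// ltW.
apply: (@le_trans _ _ ((al * (q + r) / t) ^+ 2)).
  apply: lerXn2r; rewrite ?nnegrE ?rnorm_ge0// -h3; apply: (le_trans (rnormD _ _)).
  exact: lerD.
rewrite !exprMn exprVn t2 al2 -subr_ge0.
rewrite (_ : _ - _ = (r - q) ^+ 2 / 2); first by rewrite divr_ge0 ?sqr_ge0.
by field; rewrite gt_eqF// ltr_wpDl ?sqr_ge0.
Qed.
End Stretching.

Lemma cramer2 (F : fieldType) (p q r s a b : F) : p * s - q * r != 0 ->
  let D := p * s - q * r in
  (a * s - b * r) / D * p + (b * p - a * q) / D * r = a /\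
  (a * s - b * r) / D * q + (b * p - a * q) / D * s = b.
Proof. by move=> D0; split; field. Qed.

Section John.
Context (R : realType) (k : scalar_kind).
Local Notation K := (scalars R k).
Context (E : normedModType K).

(** The second vector is taken in the kernel of a functional norming the first one; so
the first coordinate is bounded by the norm, and hence the second one too. *)
Lemma coordinate_basis : has_dim E 2 -> exists u v : E,
  [/\ forall z, exists a b : K, z = a *: u + b *: v, rnorm u = 1, rnorm v = 1 &
    forall a b : K, sabs a <= 2 * rnorm (a *: u + b *: v) /\
                    sabs b <= 2 * rnorm (a *: u + b *: v)].
Proof.
move=> /has_dim2_basis[x [y [xy xyE]]].
have x0 : x != 0.
  apply/eqP => x0; have [] := xy 1 0; first by rewrite x0 scaler0 scale0r addr0.
  by move=> /eqP; rewrite oner_eq0.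
have nx0 : 0 < rnorm x by rewrite rnorm_gt0.
have [F [F1 Fx]] := norming_functional x.
have sFx : sabs (F x) = rnorm x.
  by apply/le_anti; rewrite F1 (le_trans Fx (toR_le_sabs _)).
have Fx0 : F x != 0 by rewrite -sabs_eq0 sFx gt_eqF.
pose c : K := F y / F x; pose y' := y - c *: x.
have Fy' : F y' = 0.
  by rewrite /y' linearB linearZ /= -[_ *: F x]/(c * F x) divfK// subrr.
have y'0 : y' != 0.
  apply/eqP => y'0; have [] := xy (- c) 1.
    by rewrite scaleNr scale1r addrC.
  by move=> _ /eqP; rewrite oner_eq0.
have ny0 : 0 < rnorm y' by rewrite rnorm_gt0.
pose u := ofR k (rnorm x)^-1 *: x; pose v := ofR k (rnorm y')^-1 *: y'.
have nu : rnorm u = 1.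
  by rewrite rnormZ sabs_ofR ?invr_ge0 ?ltW// mulVf// gt_eqF.
have nv : rnorm v = 1.
  by rewrite rnormZ sabs_ofR ?invr_ge0 ?ltW// mulVf// gt_eqF.
have ux : x = ofR k (rnorm x) *: u.
  by rewrite scalerA -ofRM mulfV ?gt_eqF// ofR1 scale1r.
have vy : y' = ofR k (rnorm y') *: v.
  by rewrite scalerA -ofRM mulfV ?gt_eqF// ofR1 scale1r.
exists u, v; split=> // [z|a b].
  have [a [b ->]] := xyE z.
  exists ((a + b * c) * ofR k (rnorm x)), (b * ofR k (rnorm y')).
  rewrite -!scalerA -ux -vy /y' scalerBr scalerDl -scalerA.
  by rewrite -addrA [_ + (_ - _)]addrC subrK.
have ha : sabs a <= rnorm (a *: u + b *: v).
  apply: le_trans (F1 _); rewrite linearD !linearZ /= Fy' !scaler0 addr0.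
  rewrite -[_ *: (_ *: _)]/(a * (ofR k (rnorm x)^-1 * F x)) !sabsM sFx.
  by rewrite sabs_ofR ?invr_ge0 ?(ltW nx0)// mulVf ?gt_eqF// mulr1.
have n0 := rnorm_ge0 (a *: u + b *: v).
split; first by lra.
have := rnormD (a *: u + b *: v) (- (a *: u)).
by rewrite addrAC subrr add0r rnormN (rnormZ a u) (rnormZ b v) nu nv; lra.
Qed.

(** Take a contractive pair (x, y) whose determinant is within a factor less than
(w + 1 / w) / 2 of the supremum. If the bound failed at (a, b), a rotation would bring
the normalisation of a x + b y to the first place of a contractive pair with the same
determinant, and stretching this pair would exceed the supremum. *)
Lemma john_pair (w : R) : has_dim E 2 -> 1 < w -> exists x y : E,
  [/\ contractive_pair x y, forall z, exists a b : K, z = a *: x + b *: y &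
    forall a b : K, sabs a ^+ 2 + sabs b ^+ 2 <=
                    (w ^+ 2 + 1) * rnorm (a *: x + b *: y) ^+ 2].
Proof.
move=> /coordinate_basis[u [v [uvE nu nv uvK]]] w1.
pose P p q r s := contractive_pair (p *: u + q *: v) (r *: u + s *: v).
pose S : set R := [set d | exists p q r s : K, P p q r s /\ d = sabs (p * s - q * r)].
have Sub : ubound S 8.
  move=> _ [p [q [r [s [h ->]]]]].
  have nx : rnorm (p *: u + q *: v) <= 1.
    rewrite -(@ler_pXn2r _ 2)// ?nnegrE ?rnorm_ge0//.
    by have := h 1 0; rewrite !scale1r !scale0r !addr0 sabs1 sabs0 expr0n addr0.
  have ny : rnorm (r *: u + s *: v) <= 1.
    rewrite -(@ler_pXn2r _ 2)// ?nnegrE ?rnorm_ge0//.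
    by have := h 0 1; rewrite !scale1r !scale0r !add0r sabs1 sabs0 expr0n add0r.
  have [hp hq] := uvK p q; have [hr hs] := uvK r s.
  apply: (le_trans (sabsD _ _)); rewrite sabsN !sabsM.
  have m a b : 0 <= a -> 0 <= b -> a <= 2 -> b <= 2 -> a * b <= 4 :> R.
    move=> a0 b0 a2 b2; apply: (@le_trans _ _ (2 * 2)); first exact: ler_pM.
    by rewrite -natrM.
  have h1 := m _ _ (sabs_ge0 p) (sabs_ge0 s) ltac:(lra) ltac:(lra).
  have h2 := m _ _ (sabs_ge0 q) (sabs_ge0 r) ltac:(lra) ltac:(lra).
  by lra.
have h2K : sabs (ofR k 2^-1) = 2^-1 :> R by rewrite sabs_ofR// invr_ge0.
have S0 : S 4^-1.
  exists (ofR k 2^-1), 0, 0, (ofR k 2^-1); split; last first.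
    by rewrite mulr0 subr0 sabsM h2K -invfM -natrM.
  move=> a b; rewrite !scale0r addr0 add0r !scalerA.
  have : rnorm ((a * ofR k 2^-1) *: u + (b * ofR k 2^-1) *: v) <= (sabs a + sabs b) / 2.
    apply: (le_trans (rnormD _ _)); rewrite !rnormZ nu nv !mulr1 !sabsM h2K.
    by rewrite mulrDl.
  have a0 := sabs_ge0 a; have b0 := sabs_ge0 b.
  have ab0 : 0 <= (sabs a + sabs b) / 2 by rewrite divr_ge0// addr_ge0.
  rewrite -(@ler_pXn2r _ 2)// ?nnegrE ?rnorm_ge0// => /le_trans; apply.
  have := sqr_ge0 (sabs a - sabs b); have := sqr_ge0 (sabs a + sabs b).
  by move=> h1 h2; rewrite exprMn; nra.
have hS : has_sup S by split; [exists 4^-1|exists 8].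
have M0 : 0 < sup S.
  by apply: (@lt_le_trans _ _ 4^-1); [rewrite invr_gt0|exact: sup_upper_bound].
have w0 : 0 < w by rewrite (lt_trans _ w1).
pose al := Num.sqrt ((w ^+ 2 + 1) / 2).
have al2 : al ^+ 2 = (w ^+ 2 + 1) / 2.
  by rewrite sqr_sqrtr// divr_ge0// addr_ge0// sqr_ge0.
(* The factor by which stretching multiplies the determinant. *)
pose ka := al * (al / w).
have ka1 : 1 < ka.
  rewrite /ka mulrA -expr2 al2 ltr_pdivlMr// mul1r ltr_pdivlMr// -subr_gt0.
  rewrite (_ : _ - _ = (w - 1) ^+ 2); last by ring.
  by rewrite exprn_gt0// subr_gt0.
have ka0 : 0 < ka by rewrite (lt_trans _ ka1).
have [d [p [q [r [s [good dE]]]]] dM] : exists2 d, S d & sup S / ka < d.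
  by apply: sup_gt; [case: hS|rewrite ltr_pdivrMr// -[ltLHS]mulr1 ltr_pM2l].
rewrite ltr_pdivrMr// in dM.
pose D : K := p * s - q * r.
have D0 : D != 0.
  by rewrite -sabs_eq0 -/D -dE gt_eqF// -(pmulr_lgt0 _ ka0) (lt_trans M0).
exists (p *: u + q *: v), (r *: u + s *: v); split=> // [z|a b].
  have [a [b ->]] := uvE z.
  exists ((a * s - b * r) / D), ((b * p - a * q) / D).
  have [ea eb] := cramer2 a b D0.
  by rewrite !scalerDr !scalerA addrACA -!scalerDl ea eb.
rewrite leNgt; apply/negP => lt; set x := p *: u + q *: v in lt.
set y := r *: u + s *: v in lt.
pose n := Num.sqrt (sabs a ^+ 2 + sabs b ^+ 2).
have n2 : n ^+ 2 = sabs a ^+ 2 + sabs b ^+ 2.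
  by rewrite sqr_sqrtr// addr_ge0// sqr_ge0.
have n0 : 0 < n.
  rewrite sqrtr_gt0; apply: le_lt_trans lt.
  by rewrite mulr_ge0 ?sqr_ge0// addr_ge0// sqr_ge0.
pose a' := ofR k n^-1 * a; pose b' := ofR k n^-1 * b.
have nV : sabs (ofR k n^-1) = n^-1 by rewrite sabs_ofR// invr_ge0 ltW.
have ab1 : sabs a' ^+ 2 + sabs b' ^+ 2 = 1.
  rewrite !sabsM nV !exprMn -mulrDr -n2 -exprMn mulVf ?gt_eqF//.
  by rewrite expr1n.
pose x' := a' *: x + b' *: y; pose y' := - sconj b' *: x + sconj a' *: y.
have good' : contractive_pair x' y' by exact: contractive_pair_rotate.
have x'1 : (w ^+ 2 + 1) * rnorm x' ^+ 2 <= 1.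
  rewrite (_ : x' = ofR k n^-1 *: (a *: x + b *: y)); last by rewrite scalerDr !scalerA.
  rewrite rnormZ nV exprMn mulrCA exprVn ler_pdivrMl ?exprn_gt0// mulr1 n2.
  exact: ltW.
have := contractive_pair_stretch (ltW w1) (sqrtr_ge0 _) al2 good' x'1.
rewrite -/al => good''.
suff : S (ka * d).
  by move/(sup_upper_bound hS); rewrite leNgt mulrC dM.
pose A := ofR k al; pose B := ofR k (al / w).
exists (A * (a' * p + b' * r)), (A * (a' * q + b' * s)),
  (B * (- sconj b' * p + sconj a' * r)), (B * (- sconj b' * q + sconj a' * s)).
split.
  rewrite /P -!scalerA -!scalerDr.
  rewrite (_ : _ *: u + _ = x'); last first.
    by rewrite /x' /x /y !scalerDr !scalerA addrACA -!scalerDl.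
  rewrite (_ : _ *: u + _ = y')//.
  by rewrite /y' /x /y !scalerDr !scalerA addrACA -!scalerDl.
rewrite (_ : _ - _ = A * B * ((a' * sconj a' + b' * sconj b') * D)); last first.
  by rewrite /D; ring.
rewrite !mul_sconj -ofRD ab1 ofR1 mul1r /A /B -ofRM sabsM sabs_ofR -/ka ?(ltW ka0)//.
by rewrite dE.
Qed.

Definition ell22_vec (a b : K) : ell22 R k :=
  \row_(i < 2) if i == ord0 then a else b.

Lemma banach_mazur_pair_le (x y : E) (t : R) : 0 <= t ->
  contractive_pair x y -> (forall z, exists a b : K, z = a *: x + b *: y) ->
  (forall a b : K, sabs a ^+ 2 + sabs b ^+ 2 <= t ^+ 2 * rnorm (a *: x + b *: y) ^+ 2) ->
  (banach_mazur E (ell22 R k) <= t%:E)%E.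
Proof.
move=> t0 xy xyE xyt.
pose f (v : ell22 R k) : E :=
  (v : 'rV[K]_2) ord0 ord0 *: x + (v : 'rV[K]_2) ord0 (lift ord0 ord0) *: y.
have fvec a b : f (ell22_vec a b) = a *: x + b *: y by rewrite /f !mxE.
have flin : linear f.
  by move=> a v w; rewrite /f !mxE scalerDr !scalerDl !scalerA addrACA.
pose fl : {linear ell22 R k -> E} := HB.pack f (GRing.isLinear.Build _ _ _ *:%R f flin).
have [S [Sf S1]] : exists S : boundedOp (ell22 R k) E,
    (forall v, S v = fl v) /\ opnorm S <= 1.
  apply: bounded_op => // v; rewrite mul1r -(@ler_pXn2r _ 2)// ?nnegrE ?rnorm_ge0//.
  by rewrite ell22_sqnorm; exact: xy.
have ft v : rnorm v <= t * rnorm (f v).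
  rewrite -(@ler_pXn2r _ 2)// ?nnegrE ?mulr_ge0 ?rnorm_ge0// exprMn ell22_sqnorm.
  exact: xyt.
have /choice[g gP] : forall z, exists v, f v = z.
  by move=> z; have [a [b ->]] := xyE z; exists (ell22_vec a b).
have finj : injective fl.
  move=> v w vw; apply/eqP; rewrite -subr_eq0; apply/eqP/rnorm0_eq0/le_anti.
  rewrite rnorm_ge0 andbT; apply: (le_trans (ft _)).
  by rewrite -[f _]/(fl _) linearB vw subrr rnorm0 mulr0.
have glin : linear g.
  by move=> a z w; apply: finj; rewrite linearP /= !gP.
pose gl : {linear E -> ell22 R k} := HB.pack g (GRing.isLinear.Build _ _ _ *:%R g glin).
have [T [Tg Tt]] : exists T : boundedOp E (ell22 R k),
    (forall z, T z = gl z) /\ opnorm T <= t.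
  by apply: bounded_op => // z; rewrite -{2}(gP z); exact: ft.
apply: (@le_trans _ _ (opnorm T * opnorm S)%:E).
  apply: ereal_inf_lbound; exists T, S; split=> //.
    by move=> z; rewrite Sf Tg /= gP.
  by move=> v; apply: finj; rewrite Sf Tg /= gP.
by rewrite lee_fin -[leRHS]mulr1 ler_pM ?opnorm_ge0.
Qed.

Theorem banach_mazur_le_sqrt2 : has_dim E 2 ->
  (banach_mazur E (ell22 R k) <= (Num.sqrt 2)%:E)%E.
Proof.
move=> dE; apply/lee_addgt0Pr => e e0; rewrite -EFinD; set t := _ + e.
have s0 := sqrtr_ge0 (2 : R).
have t0 : 0 <= t by rewrite /t addr_ge0// ltW.
have t2 : 2 < t ^+ 2.
  rewrite -[ltLHS](@sqr_sqrtr _ (2 : R))// ltrXn2r ?nnegrE//.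
  by rewrite /t ltrDl.
have w1 : 1 < Num.sqrt (t ^+ 2 - 1).
  by rewrite -[ltLHS]sqrtr1 ltr_sqrt; lra.
have [x [y [xy xyE xyt]]] := john_pair dE w1.
apply: (@banach_mazur_pair_le x y) => // a b.
by have := xyt a b; rewrite sqr_sqrtr ?subrK//; lra.
Qed.

End John.

(** * Helly's theorem and dual bases *)

Section Helly.
Context (R : realType) (k : scalar_kind).
Local Notation K := (scalars R k).
Context (X : normedModType K).

Definition dist_to (N : {pred X}) (x : X) : R :=
  inf [set rnorm (x - z) | z in [set z | z \in N]].

Section Distance.
Context (N : {pred X}) (subN : submod_closed N).

Let N0 : 0 \in N. Proof. by case: subN. Qed.

Let dist_le x z : z \in N -> dist_to N x <= rnorm (x - z).
Proof.
move=> Nz; apply: ge_inf; last by exists z.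
by exists 0 => _ [y _ <-]; exact: rnorm_ge0.
Qed.

Let dist_ge x (c : R) : (forall z, z \in N -> c <= rnorm (x - z)) -> c <= dist_to N x.
Proof.
move=> h; apply: lb_le_inf; last by move=> _ [z Nz <-]; exact: h.
by exists (rnorm (x - 0)); exists 0.
Qed.

Let distD x y : dist_to N (x + y) <= dist_to N x + dist_to N y.
Proof.
rewrite -lerBlDr; apply: dist_ge => z Nz; rewrite lerBlDr -lerBlDl.
apply: dist_ge => t Nt; rewrite lerBlDl.
have Nzt : z + t \in N by rewrite -[z]scale1r; case: subN => _ ->.
by apply: (le_trans (dist_le _ Nzt)); rewrite opprD addrACA rnormD.
Qed.

Let distZ a x : dist_to N (a *: x) = sabs a * dist_to N x.
Proof.
have le b y : b != 0 -> dist_to N (b *: y) <= sabs b * dist_to N y.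
  move=> b0; have sb0 : 0 < sabs b by rewrite sabs_gt0.
  rewrite -ler_pdivrMl//; apply: dist_ge => z Nz; rewrite ler_pdivrMl// -rnormZ scalerBr.
  by apply: dist_le; rewrite -[_ *: z]addr0; case: subN => _ ->.
have [->|a0] := eqVneq a 0.
  rewrite scale0r sabs0 mul0r; apply/le_anti/andP; split.
    by apply: (le_trans (dist_le _ N0)); rewrite subr0 rnorm0.
  by apply: dist_ge => z _; exact: rnorm_ge0.
apply/le_anti; rewrite le//=.
have := le a^-1 (a *: x); rewrite invr_eq0 => /(_ a0).
rewrite scalerA mulVf// scale1r sabsV.
by rewrite ler_pdivlMl ?sabs_gt0.
Qed.

Definition dist_seminorm : seminorm X := Seminorm distD distZ.

Lemma dist_seminormP x :
  dist_seminorm x <= rnorm x /\ (x \in N -> dist_seminorm x <= 0).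
Proof.
split; first by have := dist_le x N0; rewrite subr0.
by move=> Nx; have := dist_le x Nx; rewrite subrr rnorm0.
Qed.

Lemma dist_seminorm_lt x (c : R) :
  dist_seminorm x < c -> exists z, z \in N /\ rnorm (x - z) < c.
Proof.
move=> /inf_lt h; have [|_ [z Nz <-] zc] := h; last by exists z.
by exists (rnorm (x - 0)); exists 0.
Qed.

End Distance.

Lemma functional_multiple (f g : {linear X -> K^o}) :
  (forall x, f x = 0 -> g x = 0) -> exists c : K, forall x, g x = c * f x.
Proof.
move=> fg; have [[x fx]|h] := pselect (exists x, f x != 0); last first.
  exists 0 => x; rewrite mul0r fg//; apply: contrapT => /eqP fx.
  by apply: h; exists x.
exists (g x / f x) => y; have : g (y - (f y / f x) *: x) = 0.
  by apply: fg; rewrite linearB linearZ /= -[_ *: f x]/(_ * f x) divfK// subrr.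
rewrite linearB linearZ /= -[_ *: g x]/(_ * g x) => /eqP; rewrite subr_eq0 => /eqP ->.
by rewrite mulrAC [f y * _]mulrC mulrAC.
Qed.

(** Helly's theorem for two functionals. Start from any solution x0 of the two
equations. A functional G bounded by the distance to the common kernel N of f1 and f2,
and attaining it at x0, is a combination of f1 and f2 whose first coefficient is G x0
and whose norm is at most 1; so the distance from x0 to N is at most M. *)
Lemma helly2 (f1 f2 : boundedOp X K^o) (M e : R) : 0 < e ->
  (forall c1 c2 : K, sabs c1 <= M * opnorm (c1 *: f1 + c2 *: f2)) ->
  exists x : X, [/\ f1 x = 1, f2 x = 0 & rnorm x <= M + e].
Proof.
move=> e0 hM.
have [x0 [f1x0 f2x0]] : exists x0, f1 x0 = 1 /\ f2 x0 = 0.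
  have [[x [fx gx]]|h] := pselect (exists x, f2 x = 0 /\ f1 x <> 0).
    exists ((f1 x)^-1 *: x); rewrite !linearZ /= fx scaler0; split=> //.
    by apply: mulVf; exact/eqP.
  have [|c hc] := @functional_multiple f2 f1.
    by move=> x fx; apply: contrapT => gx; apply: h; exists x.
  have := hM 1 (- c); rewrite (_ : _ + _ = 0) ?sabs1.
    by rewrite -rnorm_boundedOp rnorm0 mulr0 ler10.
  apply/val_inj/funext => x /=; apply/eqP.
  rewrite -[X in X == _]/(1 * f1 x + - c * f2 x).
  by rewrite mul1r mulNr hc subrr.
pose N : {pred X} := [pred z | (f1 z == 0) && (f2 z == 0)].
have subN : submod_closed N.
  split; first by rewrite inE /= !linear0 eqxx.
  move=> a x y; rewrite !inE /= => /andP[/eqP x1 /eqP x2] /andP[/eqP y1 /eqP y2].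
  by rewrite !linearP /= x1 x2 y1 y2 !scaler0 !addr0 eqxx.
have [G [Gp Gx0]] := hahn_banach (dist_seminorm subN) x0.
have G1 x : sabs (G x) <= rnorm x := le_trans (Gp x) (dist_seminormP subN x).1.
have GN x : x \in N -> G x = 0.
  move=> Nx; apply/eqP; rewrite -sabs_eq0 eq_le sabs_ge0 andbT.
  exact: le_trans (Gp x) ((dist_seminormP subN x).2 Nx).
pose g : {linear X -> K^o} := G \- (G x0 \*: f1).
have [|c hc] := @functional_multiple f2 g.
  move=> x fx; have : x - f1 x *: x0 \in N.
    rewrite inE /= !linearB !linearZ /= f1x0 f2x0 fx oppr0 scaler0 addr0 eqxx andbT.
    by rewrite -[_ *: -1]/(f1 x * -1) mulrN1 subrr.
  move=> /GN; rewrite linearB linearZ /= => /eqP; rewrite subr_eq0 => /eqP ->.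
  by rewrite -[f1 x *: _]/(f1 x * G x0) -[_ *: f1 x]/(G x0 * f1 x) mulrC subrr.
have : dist_seminorm subN x0 < M + e.
  apply: (@le_lt_trans _ _ M); last by rewrite ltrDl.
  apply: (le_trans Gx0); apply: (le_trans (toR_le_sabs _)).
  apply: (le_trans (hM (G x0) c)).
  have M0 : 0 < M.
    have := hM 1 0; rewrite sabs1 leNgt => h; rewrite ltNge; apply: contra h => M0.
    by apply: le_lt_trans ltr01; rewrite mulr_le0_ge0 ?opnorm_ge0.
  rewrite -[leRHS]mulr1 ler_wpM2l ?(ltW M0)//.
  apply: opnorm_le_bound => // x; rewrite mul1r; apply: le_trans (G1 x).
  rewrite (_ : (_ + _ : boundedOp _ _) x = G x)//.
  rewrite -[LHS]/(G x0 * f1 x + c * f2 x) -hc /=.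
  by rewrite addrC subrK.
move=> /dist_seminorm_lt[z [/andP[/eqP z1 /eqP z2] zM]].
exists (x0 - z); rewrite !linearB /= f1x0 f2x0 z1 z2 !subr0; split=> //.
exact: ltW.
Qed.

(** For an isomorphism T of a plane of the dual with ell_2^2, of inverse S, the
functionals f1 and f2 are the images of the standard basis by S. The norm s of S bounds
x |-> (f1 x, f2 x), and the norm of T bounds the coefficients of a combination of f1
and f2, so that Helly's theorem gives x1 and x2 of norm at most t, slightly larger. *)
Lemma eta2_dual_basis (d : R) : (eta2 (dual X) < d%:E)%E ->
  exists (f1 f2 : boundedOp X K^o) (x1 x2 : X) (s t : R),
  [/\ [/\ f1 x1 = 1, f2 x1 = 0, f1 x2 = 0 & f2 x2 = 1],
      rnorm x1 <= t /\ rnorm x2 <= t,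
      forall x, sabs (f1 x) ^+ 2 + sabs (f2 x) ^+ 2 <= s ^+ 2 * rnorm x ^+ 2 &
      0 <= s /\ s * t <= d].
Proof.
move=> /ereal_inf_lt[_ [E [dE ->]]] /ereal_inf_lt[_ [T [S [TS ST ->]]]].
rewrite lte_fin => TSd.
pose f1 : dual X := val (S (ell22_vec 1 0)); pose f2 : dual X := val (S (ell22_vec 0 1)).
have Sval (a b : K) : val (S (ell22_vec a b)) = a *: f1 + b *: f2.
  have -> : ell22_vec a b = a *: ell22_vec 1 0 + b *: ell22_vec 0 1.
    by apply/matrixP => i j; rewrite !mxE; case: ifP => _;
      rewrite !(mulr1, mulr0, addr0, add0r).
  by rewrite linearD !linearZ.
have nvec (a b : K) : rnorm (ell22_vec a b) ^+ 2 = sabs a ^+ 2 + sabs b ^+ 2.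
  by rewrite ell22_sqnorm !mxE.
have nS v : rnorm (val (S v)) <= opnorm S * rnorm v := le_opnorm S v.
have nT (a b : K) : rnorm (ell22_vec a b) <= opnorm T * opnorm (a *: f1 + b *: f2).
  rewrite -{1}(ST (ell22_vec a b)); apply: (le_trans (le_opnorm T _)).
  by rewrite -[opnorm (a *: f1 + _)]rnorm_boundedOp -Sval.
have [s0 t0] := (opnorm_ge0 S, opnorm_ge0 T).
pose e : R := (d - opnorm T * opnorm S) / (opnorm S + 1).
have e0 : 0 < e by rewrite divr_gt0 ?subr_gt0// ltr_wpDl.
have [|x1 [f1x1 f2x1 x1M]] := @helly2 f1 f2 (opnorm T) e e0.
  move=> a b; apply: le_trans (nT a b).
  by rewrite -(@ler_pXn2r _ 2)// ?nnegrE ?rnorm_ge0 ?sabs_ge0// nvec lerDl sqr_ge0.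
have [|x2 [f2x2 f1x2 x2M]] := @helly2 f2 f1 (opnorm T) e e0.
  move=> b a; rewrite addrC; apply: le_trans (nT a b).
  by rewrite -(@ler_pXn2r _ 2)// ?nnegrE ?rnorm_ge0 ?sabs_ge0// nvec lerDr sqr_ge0.
exists f1, f2, x1, x2, (opnorm S), (opnorm T + e); split=> //; last first.
  split=> //; rewrite mulrDr [X in X + _]mulrC -lerBrDl /e mulrCA.
  by rewrite ler_piMr ?subr_ge0 ?(ltW TSd)// ler_pdivrMr ?ltr_wpDl// mul1r lerDl.
move=> x; set n2 := _ + _; have n20 : 0 <= n2 by rewrite addr_ge0 ?sqr_ge0.
(* The combination of f1 and f2 whose value at x is |f1 x|^2 + |f2 x|^2. *)
pose a := sconj ((f1 : boundedOp X K^o) x); pose b := sconj ((f2 : boundedOp X K^o) x).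
have sconj_abs (c : K) : sabs (sconj c) = sabs c.
  apply/eqP; rewrite -(@eqrXn2 _ 2)// ?sabs_ge0//; apply/eqP/(@ofR_inj R k).
  by rewrite -!mul_sconj sconjK mulrC.
have nab : rnorm (ell22_vec a b) ^+ 2 = n2 by rewrite nvec !sconj_abs.
have : n2 <= opnorm S * rnorm (ell22_vec a b) * rnorm x.
  apply: (@le_trans _ _ (rnorm (val (S (ell22_vec a b))) * rnorm x)); last first.
    by rewrite ler_wpM2r ?rnorm_ge0.
  rewrite rnorm_boundedOp; apply: le_trans (le_opnorm _ x); rewrite Sval.
  rewrite -[rnorm _]/(sabs (a * (f1 : boundedOp X K^o) x + b * (f2 : boundedOp X K^o) x)).
  by rewrite mulrC [b * _]mulrC !mul_sconj -ofRD sabs_ofR.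
rewrite -nab mulrAC expr2; set n := rnorm _; have [->|n0] := eqVneq n 0.
  by rewrite !mulr0 => _; rewrite mulr_ge0 ?sqr_ge0.
rewrite ler_pM2r ?lt_neqAle 1?eq_sym ?n0 ?rnorm_ge0// => h.
by rewrite -expr2 -exprMn lerXn2r ?nnegrE ?mulr_ge0 ?rnorm_ge0.
Qed.

End Helly.

(** * The three constants *)

Section Constants.
Context (R : realType) (k : scalar_kind).
Local Notation K := (scalars R k).

Lemma has_dim2_neq0 (E : normedModType K) : has_dim E 2 -> exists x : E, x != 0.
Proof.
move=> /has_dim2_basis[x [y [xy _]]]; exists x; apply/eqP => x0.
have [] := xy 1 0; first by rewrite x0 scaler0 scale0r addr0.
by move=> /eqP; rewrite oner_eq0.
Qed.

Lemma eta2_ge1 (Z : normedModType K) : (1 <= eta2 Z)%E.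
Proof.
apply: le_ereal_inf_tmp => _ [E [/has_dim2_neq0 E0 ->]].
exact: banach_mazur_ge1.
Qed.

(** When Z has dimension at least two, any two vectors lie in a plane, whose distance to
ell_2^2 is at most Theta2 Z; on a line the parallelogram law holds exactly. *)
Lemma Theta2_parallelogram (Z : normedModType K) : (exists z : Z, z <> 0) ->
  exists c : R, [/\ Theta2 Z = c%:E, 0 <= c, c ^+ 2 <= 2 &
    forall x y : Z, rnorm (x + y) ^+ 2 + rnorm (x - y) ^+ 2 <=
      2 * c ^+ 2 * (rnorm x ^+ 2 + rnorm y ^+ 2)].
Proof.
move=> Z0; rewrite /Theta2; case: asboolP => [[e eE]|d1].
  exists 1; split=> //; first by rewrite expr1n ler1n.
  move=> x y; have [c [-> _]] := eE x; have [d [-> _]] := eE y.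
  rewrite !big_ord1 -scalerDl -scalerBl !rnormZ !exprMn -!mulrDl sabs_parallelogram.
  by rewrite expr1n mulr1 mulrA.
set S := [set r | _].
have SP r : S r -> (1 <= r <= (Num.sqrt 2)%:E)%E.
  move=> [E [dE ->]]; rewrite banach_mazur_le_sqrt2// banach_mazur_ge1//.
  exact: has_dim2_neq0.
have planeS (x y : Z) : lin_indep2 x y ->
    S (banach_mazur (subspaceOf (span2 x y)) (ell22 R k)).
  move=> xy; exists (GRing.SubmodClosed.clone _ _ (span2 x y) _).
  by split=> //; exact: span2_dim.
have S1 : (1 <= ereal_sup S)%E.
  have [z z0] := Z0; have [y zy] := lin_indep2_exists z0 d1.
  apply: le_ereal_sup_tmp; exists (banach_mazur (subspaceOf (span2 z y)) (ell22 R k)).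
    exact: planeS.
  by have /SP/andP[] := planeS _ _ zy.
have S2 : (ereal_sup S <= (Num.sqrt 2)%:E)%E.
  by apply: ge_ereal_sup => r /SP/andP[].
have [c Sc] : exists c, ereal_sup S = c%:E.
  by move: S1 S2; case: (ereal_sup S) => [c|//|//]; exists c.
rewrite Sc in S1 S2 *; rewrite lee_fin in S1; rewrite lee_fin in S2.
have c0 : 0 <= c by rewrite (le_trans ler01).
exists c; split=> //.
  by rewrite -[leRHS](@sqr_sqrtr _ (2 : R))// lerXn2r ?nnegrE ?sqrtr_ge0.
move=> x y; have [u [v [uv ux vy]]] := span2_through x y Z0 d1.
have := @banach_mazur_parallelogram R k (subspaceOf (span2 u v)) c
  (SubspaceOf ux) (SubspaceOf vy) c0.
by apply; rewrite -Sc; apply: ereal_sup_ubound; exact: planeS.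
Qed.

Lemma CNJ_denom_gt0 (X : normedModType K) (x y : X) : (x, y) <> (0, 0) ->
  0 < 2 * (rnorm x ^+ 2 + rnorm y ^+ 2).
Proof.
move=> xy0; rewrite mulr_gt0// lt_neqAle eq_sym addr_ge0 ?sqr_ge0// andbT.
rewrite paddr_eq0 ?sqr_ge0// !sqrf_eq0; apply/negP => /andP[/eqP x0 /eqP y0].
by apply: xy0; rewrite (rnorm0_eq0 x0) (rnorm0_eq0 y0).
Qed.

Lemma CNJ_le (X : normedModType K) (c : R) :
  (forall x y : X, rnorm (x + y) ^+ 2 + rnorm (x - y) ^+ 2 <=
     2 * c * (rnorm x ^+ 2 + rnorm y ^+ 2)) -> (CNJ X <= c%:E)%E.
Proof.
move=> h; apply: ge_ereal_sup => _ [[x y] /= xy0 <-]; rewrite lee_fin.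
by rewrite ler_pdivrMr ?mulrA 1?[c * 2]mulrC//; exact: CNJ_denom_gt0.
Qed.

Lemma le_CNJ (X : normedModType K) (c : R) (x y : X) : (CNJ X <= c%:E)%E ->
  rnorm (x + y) ^+ 2 + rnorm (x - y) ^+ 2 <= 2 * c * (rnorm x ^+ 2 + rnorm y ^+ 2).
Proof.
move=> Xc; have [xy0|xy0] := pselect ((x, y) = (0, 0)).
  by case: xy0 => -> ->; rewrite subrr addr0 rnorm0 expr0n !(addr0, mulr0).
have : (((rnorm (x + y) ^+ 2 + rnorm (x - y) ^+ 2) /
    (2 * (rnorm x ^+ 2 + rnorm y ^+ 2)))%:E <= CNJ X)%E.
  by apply: ereal_sup_ubound; exists (x, y).
move=> /le_trans/(_ Xc); rewrite lee_fin ler_pdivrMr ?mulrA 1?[c * 2]mulrC//.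
exact: CNJ_denom_gt0.
Qed.

Lemma CNJ_ge0 (X : normedModType K) : (exists x : X, x <> 0) -> (0 <= CNJ X)%E.
Proof.
move=> [x x0]; apply: le_ereal_sup_tmp.
exists ((rnorm (x + 0) ^+ 2 + rnorm (x - 0) ^+ 2) /
    (2 * (rnorm x ^+ 2 + rnorm (0 : X) ^+ 2)))%:E.
  by exists (x, 0) => // -[].
by rewrite lee_fin divr_ge0 ?mulr_ge0 ?addr_ge0 ?sqr_ge0.
Qed.

Lemma CNJ_isometry (X Y : normedModType K) (f : {linear X -> Y}) :
  (forall x, rnorm (f x) = rnorm x) -> (CNJ X <= CNJ Y)%E.
Proof.
move=> fE; apply: ereal_sup_le => _ [[x y] /= xy0 <-].
exists (f x, f y) => /=; last by rewrite -linearD -linearB !fE.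
move=> [fx fy]; apply: xy0; congr (_, _); apply: rnorm0_eq0.
  by rewrite -fE fx rnorm0.
by rewrite -fE fy rnorm0.
Qed.

Lemma unit_vector (X : normedModType K) : (exists x : X, x <> 0) ->
  exists x : X, rnorm x = 1.
Proof.
move=> [x /eqP x0]; have nx : 0 < rnorm x by rewrite rnorm_gt0.
exists (ofR k (rnorm x)^-1 *: x).
by rewrite rnormZ sabs_ofR ?invr_ge0 ?ltW// mulVf// gt_eqF.
Qed.

Section TensorProduct.
Context (X Y : normedModType K).

Local Notation tensc x y := (completion_in (proj_seminorm X Y) (tens x y)).

Lemma CNJ_proj_tensor_l : (exists y : Y, y <> 0) -> (CNJ X <= CNJ (proj_tensor X Y))%E.
Proof.
move=> /unit_vector[y y1]; pose f x : proj_tensor X Y := tensc x y.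
have fl : linear f by move=> a x z; rewrite /f linearPl linearP.
pose F : {linear X -> proj_tensor X Y} :=
  HB.pack f (GRing.isLinear.Build _ _ _ *:%R f fl).
by apply: (CNJ_isometry (f := F)) => x; rewrite /= /f rnorm_tens y1 mulr1.
Qed.

Lemma CNJ_proj_tensor_r : (exists x : X, x <> 0) -> (CNJ Y <= CNJ (proj_tensor X Y))%E.
Proof.
move=> /unit_vector[x x1]; pose f y : proj_tensor X Y := tensc x y.
have fl : linear f by move=> a y z; rewrite /f linearPr linearP.
pose F : {linear Y -> proj_tensor X Y} :=
  HB.pack f (GRing.isLinear.Build _ _ _ *:%R f fl).
by apply: (CNJ_isometry (f := F)) => y; rewrite /= /f rnorm_tens x1 mul1r.
Qed.

Lemma operator_neq0 : (exists x : X, x <> 0) -> (exists y : Y, y <> 0) ->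
  exists A : boundedOp X (dual Y), A <> 0.
Proof.
move=> /unit_vector[x x1] /unit_vector[y y1].
have [F [F1 Fxy]] := norming_functional (tensc x y).
have F1' u : sabs (F u) <= 1 * rnorm u by rewrite mul1r.
have [A [_ AF]] := form_operator ler01 F1'.
exists A => A0; move: Fxy; rewrite -AF A0 rnorm_tens x1 y1 mulr1.
by rewrite -[op_form _ _ _]/(0 : K) -(@ofR0 R k) ofRK; apply/negP; rewrite -ltNge.
Qed.

(** For u = x1 (x) y1 and v = x2 (x) y2, the forms f1 (x) g1 + f2 (x) g2 and
f1 (x) g1 - f2 (x) g2 take the value 2 at u + v and at u - v, and by the Cauchy-Schwarz
inequality their norms are at most s s'; the norms of u and v are at most t t'. *)
Lemma eta2_CNJ_bound (c d d' : R) : (CNJ (proj_tensor X Y) <= c%:E)%E ->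
  (eta2 (dual X) < d%:E)%E -> (eta2 (dual Y) < d'%:E)%E ->
  2 <= c * (d ^+ 2 * d' ^+ 2).
Proof.
move=> hc /eta2_dual_basis[f1 [f2 [x1 [x2 [s [t [fx [nx1 nx2] fs [s0 st]]]]]]]].
have [f11 f21 f12 f22] := fx.
move=> /eta2_dual_basis[g1 [g2 [y1 [y2 [s' [t' [gy [ny1 ny2] gs [s'0 st']]]]]]]].
have [g11 g21 g12 g22] := gy.
(* The signs of the two forms are treated at once; the factor e^-1 makes the value 2. *)
have form_ge (e : K) : sabs e = 1 ->
    2 <= s * s' * rnorm (tensc x1 y1 + tensc (e^-1 *: x2) y2).
  move=> e1; pose h x y : K^o := f1 x * g1 y + e * (f2 x * g2 y).
  have hP : bilinear_for *:%R *:%R h.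
    split=> [w a z u|w a z u]; rewrite /h !linearP /=.
      rewrite -![_ *: (_ : K^o)]/(_ * _); ring.
    rewrite -![_ *: (_ : K^o)]/(_ * _); ring.
  have hM x y : sabs (h x y) <= s * s' * (rnorm x * rnorm y).
    apply: (@le_trans _ _ (sabs (f1 x) * sabs (g1 y) + sabs (f2 x) * sabs (g2 y))).
      by apply: (le_trans (sabsD _ _)); rewrite !sabsM e1 mul1r.
    rewrite -(@ler_pXn2r _ 2)// ?nnegrE ?addr_ge0 ?mulr_ge0 ?sabs_ge0 ?rnorm_ge0//.
    apply: (@le_trans _ _ ((sabs (f1 x) ^+ 2 + sabs (f2 x) ^+ 2) *
                           (sabs (g1 y) ^+ 2 + sabs (g2 y) ^+ 2))).
      rewrite -subr_ge0 (_ : _ - _ =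
          (sabs (f1 x) * sabs (g2 y) - sabs (f2 x) * sabs (g1 y)) ^+ 2).
        exact: sqr_ge0.
      by ring.
    rewrite mulrACA exprMn [(s * rnorm x) ^+ 2]exprMn [(s' * rnorm y) ^+ 2]exprMn.
    by rewrite ler_pM// addr_ge0// sqr_ge0.
  have := proj_norm_form_ge [:: (x1, y1); (e^-1 *: x2, y2)] hP (mulr_ge0 s0 s'0) hM.
  rewrite !big_cons !big_nil !addr0 /= linearD; apply: le_trans.
  rewrite /h !linearZ /= f11 f21 g11 g21 f12 f22 g12 g22.
  rewrite -![_ *: (_ : K^o)]/(_ * _) !(mulr0, mulr1, addr0, add0r).
  rewrite mulfV -?sabs_eq0 ?e1 ?oner_eq0// -[1 + 1]/(2%:R : K).
  by rewrite (_ : 2%:R = ofR k 2) ?sabs_ofR// mulr2n -{1 2}(@ofR1 R k) -ofRD.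
pose u := tensc x1 y1; pose v := tensc x2 y2.
have huv : 2 <= s * s' * rnorm (u + v).
  by have := form_ge 1 (sabs1 _ _); rewrite invr1 scale1r.
have huv' : 2 <= s * s' * rnorm (u - v).
  have := form_ge (-1); rewrite sabsN sabs1 => /(_ erefl).
  have -> : tensc ((-1)^-1 *: x2) y2 = - v.
    by rewrite invrN invr1 linearZl_LR linearZ /= scaleN1r.
  by [].
have t0 : 0 <= t := le_trans (rnorm_ge0 _) nx1.
have t'0 : 0 <= t' := le_trans (rnorm_ge0 _) ny1.
have nu : rnorm u ^+ 2 <= (t * t') ^+ 2.
  by rewrite lerXn2r ?nnegrE ?rnorm_ge0 ?mulr_ge0// rnorm_tens ler_pM ?rnorm_ge0.
have nv : rnorm v ^+ 2 <= (t * t') ^+ 2.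
  by rewrite lerXn2r ?nnegrE ?rnorm_ge0 ?mulr_ge0// rnorm_tens ler_pM ?rnorm_ge0.
have h1 : 4 <= (s * s') ^+ 2 * rnorm (u + v) ^+ 2.
  rewrite -exprMn (_ : 4 = 2 ^+ 2 :> R) ?lerXn2r ?nnegrE ?mulr_ge0 ?rnorm_ge0//.
  by rewrite -natrX.
have h2 : 4 <= (s * s') ^+ 2 * rnorm (u - v) ^+ 2.
  rewrite -exprMn (_ : 4 = 2 ^+ 2 :> R) ?lerXn2r ?nnegrE ?mulr_ge0 ?rnorm_ge0//.
  by rewrite -natrX.
have h3 := le_CNJ u v hc.
have c0 : 0 <= c.
  rewrite leNgt; apply/negP => c0.
  have uv0 : rnorm (u + v) ^+ 2 <= 0.
    apply: (@le_trans _ _ (rnorm (u + v) ^+ 2 + rnorm (u - v) ^+ 2)).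
      by rewrite lerDl sqr_ge0.
    apply: (le_trans h3); rewrite mulr_le0_ge0 ?addr_ge0 ?sqr_ge0//.
    by rewrite pmulr_rle0// ltW.
  have := le_trans h1 (ler_wpM2l (sqr_ge0 (s * s')) uv0).
  by rewrite mulr0 leNgt ltr0n.
have h4 : 8 <= (s * s') ^+ 2 * (2 * c * ((t * t') ^+ 2 + (t * t') ^+ 2)).
  apply: (@le_trans _ _ ((s * s') ^+ 2 * (rnorm (u + v) ^+ 2 + rnorm (u - v) ^+ 2))).
    by rewrite mulrDr; lra.
  rewrite ler_wpM2l ?sqr_ge0//; apply: (le_trans h3).
  by rewrite ler_wpM2l ?mulr_ge0// lerD.
have h5 : (s * t) ^+ 2 * (s' * t') ^+ 2 <= d ^+ 2 * d' ^+ 2.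
  have st0 : 0 <= s * t by rewrite mulr_ge0.
  have st'0 : 0 <= s' * t' by rewrite mulr_ge0.
  have d0 := le_trans st0 st; have d'0 := le_trans st'0 st'.
  by rewrite ler_pM ?sqr_ge0// lerXn2r ?nnegrE.
apply: le_trans (ler_wpM2l c0 h5).
have -> : c * ((s * t) ^+ 2 * (s' * t') ^+ 2) =
    (s * s') ^+ 2 * (2 * c * ((t * t') ^+ 2 + (t * t') ^+ 2)) / 4 by field.
by rewrite ler_pdivlMr// -natrM.
Qed.

(** This is the limit of eta2_CNJ_bound when d and d' tend to the two indices. *)
Lemma eta2_CNJ (c : R) : (CNJ (proj_tensor X Y) <= c%:E)%E -> 0 <= c ->
  (2%:E / (eta2 (dual X) ^+ 2 * eta2 (dual Y) ^+ 2) <= c%:E)%E.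
Proof.
move=> hc c0; have := @eta2_CNJ_bound c _ _ hc.
have y2 : (+oo ^+ 2 = +oo :> \bar R)%E by rewrite /expe /= mulyy.
have y0 : (2%:E / +oo <= c%:E)%E by rewrite invey mule0 lee_fin.
have := eta2_ge1 (dual X); have := eta2_ge1 (dual Y).
case: (eta2 (dual Y)) (eta2 (dual X)) => [b||] [a||] // b1 a1.
- rewrite !lee_fin in a1 b1; move=> h.
  have a0 : 0 < a by rewrite (lt_le_trans ltr01).
  have b0 : 0 < b by rewrite (lt_le_trans ltr01).
  rewrite -!EFin_expe -EFinM inver gt_eqF ?mulr_gt0 ?exprn_gt0//.
  rewrite -EFinM lee_fin ler_pdivrMr ?mulr_gt0 ?exprn_gt0//.
  set q := c * _.
  (* Taking d = a l and d' = b l with l^4 = m leaves a single factor tending to 1. *)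
  have hq m : 1 < m -> 2 <= m * q.
    move=> m1; pose l := Num.sqrt (Num.sqrt m).
    have sqrt_gt1 (z : R) : 1 < z -> 1 < Num.sqrt z.
      by move=> z1; rewrite -[ltLHS]sqrtr1 ltr_sqrt// (lt_trans ltr01).
    have l1 : 1 < l by rewrite !sqrt_gt1.
    have lm : l ^+ 4 = m.
      by rewrite (exprM l 2 2) sqr_sqrtr ?sqrtr_ge0// sqr_sqrtr// ltW// (lt_trans ltr01).
    have := h (a * l) (b * l); rewrite !lte_fin !ltr_pMr// => /(_ l1 l1).
    by rewrite -lm (_ : c * _ = l ^+ 4 * q)// /q; ring.
  have q0 : 0 < q by have := hq 2; rewrite ltr1n => /(_ isT); lra.
  apply/ler_addgt0Pr => e e0; have := hq (1 + e / q).
  by rewrite ltrDl divr_gt0// mulrDl mul1r divfK ?gt_eqF//; apply.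
- rewrite lee_fin in b1; rewrite y2 -EFin_expe gt0_mulye ?y0// lte_fin.
  by rewrite exprn_gt0// (lt_le_trans ltr01).
- rewrite lee_fin in a1; rewrite y2 -EFin_expe gt0_muley ?y0// lte_fin.
  by rewrite exprn_gt0// (lt_le_trans ltr01).
Qed.

End TensorProduct.
End Constants.

Local Open Scope ereal_scope.

Theorem theorem4p1 (R : realType) (k : scalar_kind)
    (X Y : completeNormedModType (scalars R k))
    (X_neq0 : exists x : X, x <> 0%R) (Y_neq0 : exists y : Y, y <> 0%R) :
  [/\ maxe (maxe (CNJ X) (CNJ Y))
           (2%:E / (eta2 (dual X) ^+ 2 * eta2 (dual Y) ^+ 2))
        <= CNJ (proj_tensor X Y),
      CNJ (proj_tensor X Y) <= Theta2 (boundedOp X (dual Y)) ^+ 2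
    & Theta2 (boundedOp X (dual Y)) ^+ 2 <= 2%:E].
Proof.
have [c [-> c0 c2 cP]] := Theta2_parallelogram (operator_neq0 X_neq0 Y_neq0).
have hc : CNJ (proj_tensor X Y) <= (c ^+ 2)%:E.
  apply: CNJ_le => u v; apply: proj_tensor_parallelogram.
    by rewrite mulr_ge0 ?sqr_ge0.
  by move=> A B; have := cP A B; rewrite !rnorm_boundedOp.
rewrite -EFin_expe lee_fin; split=> //.
rewrite !ge_max CNJ_proj_tensor_l// CNJ_proj_tensor_r//=.
have C0 : 0 <= CNJ (proj_tensor X Y).
  exact: le_trans (CNJ_ge0 X_neq0) (CNJ_proj_tensor_l _ Y_neq0).
have [r Cr] : exists r, CNJ (proj_tensor X Y) = r%:E.
  by move: C0 hc; case: (CNJ _) => [r|//|//]; exists r.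
by rewrite Cr in C0 *; apply: eta2_CNJ; rewrite ?Cr.
Qed.
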